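(* (Cascade.) The set of triples in the rate region of the function computation problem with $R_X=0$ equals $\{(R_0,0,R_Y): R_0\ge H(G_{X|Y}),\ R_Y\ge H(f(X,Y))\}$.
   Context: Setup: $\mathcal X,\mathcal Y,\mathcal F$ finite, $(X_i,Y_i)_{i\ge1}$ i.i.d. copies of $(X,Y)\sim p(x,y)$, $f:\mathcal X\times\mathcal Y\to\mathcal F$ applied componentwise to sequences. An $(n,R_0,R_X,R_Y)$ code consists of encoders $\varphi_0:\mathcal X^n\to\{1,\dots,2^{nR_0}\}$, $\varphi_X:\mathcal X^n\to\{1,\dots,2^{nR_X}\}$, $\varphi_Y:\mathcal Y^n\times\{1,\dots,2^{nR_0}\}\to\{1,\dots,2^{nR_Y}\}$ and a decoder $\psi:\{1,\dots,2^{nR_X}\}\times\{1,\dots,2^{nR_Y}\}\to\mathcal F^n$, with error probability $P(\psi(\varphi_X(\mathbf X),\varphi_Y(\varphi_0(\mathbf X),\mathbf Y))\ne f(\mathbf X,\mathbf Y))$. A triple is achievable if for every $\varepsilon>0$ and all large $n$ a code with error probability $\le\varepsilon$ exists; the rate region is the closure of the achievable set. $G_{X|Y}$ is the graph with vertex set $\mathcal X$ in which $x_1,x_2$ are adjacent iff there is $y$ with $p(x_1,y)p(x_2,y)>0$ and $f(x_1,y)\ne f(x_2,y)$. The conditional graph entropy is $H(G_{X|Y})=\min I(V;X|Y)$ over random variables $V$ with $V-X-Y$ Markov, each value of $V$ an independent set of $G_{X|Y}$, and $P(X\in V)=1$. *)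

(* Defs.v *)
From mathcomp Require Import ssreflect ssrfun ssrbool eqtype ssrnat seq choice.
From mathcomp Require Import fintype finfun bigop finset.
From Stdlib Require Import Reals ZArith Classical ClassicalEpsilon.

Set Implicit Arguments.
Unset Strict Implicit.
Unset Printing Implicit Defensive.

Local Open Scope R_scope.

Definition rsum (T : finType) (g : T -> R) : R := \big[Rplus/0]_(t : T) g t.

Definition log2 (x : R) : R := ln x / ln 2.

Definition plogp (q : R) : R := if Rlt_dec 0 q then q * log2 q else 0.

(* infimum of a set of reals (0 if it has no greatest lower bound) *)
Definition is_glb (E : R -> Prop) (m : R) : Prop :=
  (forall x, E x -> m <= x) /\ (forall m', (forall x, E x -> m' <= x) -> m' <= m).

Definition Rinf (E : R -> Prop) : R :=
  match excluded_middle_informative (exists m, is_glb E m) with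
  | left H => proj1_sig (constructive_indefinite_description _ H)
  | right _ => 0
  end.

Definition is_pmf (X Y : finType) (p : X -> Y -> R) : Prop :=
  (forall x y, 0 <= p x y) /\ rsum (fun x => rsum (fun y => p x y)) = 1.

Section Defs.
Variables (X Y F : finType) (p : X -> Y -> R) (f : X -> Y -> F).

Definition pf (z : F) : R := rsum (fun x => rsum (fun y => if f x y == z then p x y else 0)).
Definition entropy_f : R := - rsum (fun z => plogp (pf z)).

Definition adjG (x1 x2 : X) : Prop :=
  exists y, 0 < p x1 y * p x2 y /\ f x1 y <> f x2 y.

Definition indep_set (S : {set X}) : Prop :=
  forall x1 x2, x1 \in S -> x2 \in S -> ~ adjG x1 x2.

(* V is given by a channel w v x = P(V = v | X = x), V taking values in
   subsets of X; the joint law is p(x,y) w(v|x), so V - X - Y is Markov. *)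
Definition pX (x : X) : R := rsum (fun y => p x y).
Definition pY (y : Y) : R := rsum (fun x => p x y).

Definition admissible_V (w : {set X} -> X -> R) : Prop :=
  (forall v x, 0 <= w v x) /\
  (forall x, rsum (fun v => w v x) = 1) /\
  (* every value of V (with positive probability) is an independent set,
     and P(X \in V) = 1 *)
  (forall v x, 0 < pX x * w v x -> indep_set v /\ x \in v).

Definition pVY (w : {set X} -> X -> R) (v : {set X}) (y : Y) : R :=
  rsum (fun x => p x y * w v x).

Definition cond_MI (w : {set X} -> X -> R) : R :=
  rsum (fun v => rsum (fun x => rsum (fun y =>
    let q := p x y * w v x in
    if Rlt_dec 0 q then q * log2 (q * pY y / (pVY w v y * p x y)) else 0))).

Definition cond_graph_entropy : R :=
  Rinf (fun r => exists w, admissible_V w /\ r = cond_MI w).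

(* number of messages for rate r at blocklength n : floor (2^{n r}) *)
Definition msgs (n : nat) (r : R) : nat :=
  Z.to_nat (up (Rpower 2 (INR n * r)) - 1).

Definition Pn (n : nat) (xs : {ffun 'I_n -> X}) (ys : {ffun 'I_n -> Y}) : R :=
  \big[Rmult/1]_(i < n) p (xs i) (ys i).

Definition fseq (n : nat) (xs : {ffun 'I_n -> X}) (ys : {ffun 'I_n -> Y})
  : {ffun 'I_n -> F} := [ffun i => f (xs i) (ys i)].

Definition err_prob (n : nat) (M0 MX MY : nat)
  (phi0 : {ffun 'I_n -> X} -> 'I_M0) (phiX : {ffun 'I_n -> X} -> 'I_MX)
  (phiY : {ffun 'I_n -> Y} -> 'I_M0 -> 'I_MY)
  (psi : 'I_MX -> 'I_MY -> {ffun 'I_n -> F}) : R :=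
  rsum (fun xs => rsum (fun ys =>
    if psi (phiX xs) (phiY ys (phi0 xs)) != fseq xs ys then Pn xs ys else 0)).

Definition achievable (R0 RX RY : R) : Prop :=
  forall eps, 0 < eps -> exists N : nat, forall n : nat, (N <= n)%nat ->
    exists (phi0 : {ffun 'I_n -> X} -> 'I_(msgs n R0))
           (phiX : {ffun 'I_n -> X} -> 'I_(msgs n RX))
           (phiY : {ffun 'I_n -> Y} -> 'I_(msgs n R0) -> 'I_(msgs n RY))
           (psi : 'I_(msgs n RX) -> 'I_(msgs n RY) -> {ffun 'I_n -> F}),
      err_prob phi0 phiX phiY psi <= eps.

Definition in_rate_region (R0 RX RY : R) : Prop :=
  forall d, 0 < d -> exists a b c, achievable a b c /\
    Rabs (a - R0) < d /\ Rabs (b - RX) < d /\ Rabs (c - RY) < d.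

End Defs.

(* Main.v *)
Require Import Defs.
From HB Require Import structures.
From mathcomp Require Import ssreflect ssrfun ssrbool eqtype ssrnat seq choice.
From mathcomp Require Import fintype finfun bigop finset.
From Stdlib Require Import Reals Lra Lia ZArith Classical ClassicalEpsilon.

(** Achievability.  Fix an admissible channel w and draw a codebook of M * K
    words i.i.d. from the law of V^n.  The encoder picks a codeword with
    probability proportional to w(v | x), and transmits only its row; the second
    node picks a codeword of that row proportionally to the likelihood of y.
    Convexity of 1/(ab) bounds the mean probability that both picks agree, without
    typical sets, and an exponential moment bound makes the error vanish when
    ln M > n I(V;X|Y).  A word v with w(v | x) > 0 determines f(x, y) letter by
    letter, and f(x, y) is then compressed to its entropy.

    Converse.  For the second rate, a set of e^(n a) words with a < H(f) has
    vanishing probability.  For the first one, let A_i be the set of letters x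
    for which the decoder, given the message and Y_j for j <> i, would be right at
    place i for every Y_i compatible with x; A_i is independent in the graph.
    Put V_i = A_i if X_i is in A_i, and V_i = {X_i} otherwise.  Then
    V_i - X_i - Y_i is Markov, V_i is almost determined by the message and Y^n,
    and Gibbs' inequality bounds the sum of the I(V_i;X_i|Y_i) by the log of the
    number of messages plus o(n). *)

Set Implicit Arguments.
Unset Strict Implicit.
Unset Printing Implicit Defensive.

Local Open Scope R_scope.

(** * Finite sums and products of reals *)

(** In the random codebook the first pick is among all M K words, with likelihood ratios of mean
    logarithm n I(V;X), the second among the K words of one row, with mean logarithm n I(V;Y). So ln
    (M K) has to exceed n I(V;X) and ln K has to stay below n I(V;Y). As V - X - Y is Markov, the
    difference of the two informations is I(V;X|Y), the price of the row index alone. Both random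
    picks are replaced by fixed ones at the end.

    The obstacle in the converse is the Markov condition: a variable that depends on Y_i need not
    come from a channel out of X_i. Hence A_i quantifies over all compatible values of Y_i. This is
    affordable: a letter outside A_i has a bad value y of positive probability, at least the
    smallest positive value pi of p, so P(X_i not in A_i) is at most the decoding error divided by
    pi.

    The rate region is a closure, so a point with R_X = 0 is only a limit of codes whose R_X may be
    positive. The converses therefore bound R_0 + R_X and R_X + R_Y, and R_X is sent to 0
    afterwards. *)

Lemma RplusA : associative Rplus.
Proof. by move=> x y z; rewrite Rplus_assoc. Qed.
Lemma RmultA : associative Rmult.
Proof. by move=> x y z; rewrite Rmult_assoc. Qed.

HB.instance Definition _ := Monoid.isComLaw.Build R 0 Rplus RplusA Rplus_comm Rplus_0_l.
HB.instance Definition _ := Monoid.isComLaw.Build R 1 Rmult RmultA Rmult_comm Rmult_1_l.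
HB.instance Definition _ := Monoid.isMulLaw.Build R 0 Rmult Rmult_0_l Rmult_0_r.
HB.instance Definition _ := Monoid.isAddLaw.Build R Rmult Rplus
  Rmult_plus_distr_r Rmult_plus_distr_l.

Definition rprod (T : finType) (g : T -> R) : R := \big[Rmult/1]_(t : T) g t.

Definition indic (b : bool) : R := if b then 1 else 0.

Definition posb (x : R) : bool := if Rlt_dec 0 x then true else false.

Lemma posbP (x : R) : reflect (0 < x) (posb x).
Proof. by rewrite /posb; case: Rlt_dec => h; constructor. Qed.

Lemma indic_ge0 (b : bool) : 0 <= indic b.
Proof. case: b => /=; lra. Qed.

Lemma indic_le1 (b : bool) : indic b <= 1.
Proof. case: b => /=; lra. Qed.

Lemma rsum_ext (T : finType) (g h : T -> R) :
  (forall t, g t = h t) -> rsum g = rsum h.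
Proof. by move=> gh; apply: eq_bigr => t _. Qed.

Lemma rsum_le (T : finType) (g h : T -> R) :
  (forall t, g t <= h t) -> rsum g <= rsum h.
Proof.
move=> gh; apply: (big_ind2 Rle) => [|a b c d ab cd|t _]; [lra|lra|exact: gh].
Qed.

Lemma rsum_ge0 (T : finType) (g : T -> R) : (forall t, 0 <= g t) -> 0 <= rsum g.
Proof. by move=> g0; apply: big_ind => [|a b|t _]; [lra|lra|exact: g0]. Qed.

Lemma rsumD (T : finType) (g h : T -> R) :
  rsum (fun t => g t + h t) = rsum g + rsum h.
Proof. exact: big_split. Qed.

Lemma rsumZl (T : finType) (a : R) (g : T -> R) :
  a * rsum g = rsum (fun t => a * g t).
Proof. exact: big_distrr. Qed.

Lemma rsumZr (T : finType) (a : R) (g : T -> R) :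
  rsum g * a = rsum (fun t => g t * a).
Proof. exact: big_distrl. Qed.

Lemma rsumB (T : finType) (g h : T -> R) :
  rsum (fun t => g t - h t) = rsum g - rsum h.
Proof.
have -> : rsum g - rsum h = rsum g + -1 * rsum h by ring.
by rewrite rsumZl -rsumD; apply: rsum_ext => t; ring.
Qed.

Lemma rsum_exch (S T : finType) (g : S -> T -> R) :
  rsum (fun s => rsum (fun t => g s t)) = rsum (fun t => rsum (fun s => g s t)).
Proof. exact: exchange_big. Qed.

Lemma rsum_pair (S T : finType) (g : S -> T -> R) :
  rsum (fun s => rsum (fun t => g s t)) = rsum (fun z : S * T => g z.1 z.2).
Proof. exact: pair_big. Qed.

Lemma rsum_prod (S T : finType) (g : S * T -> R) :
  rsum g = rsum (fun s => rsum (fun t => g (s, t))).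
Proof. by rewrite rsum_pair; apply: rsum_ext; case. Qed.

Lemma rsum0 (T : finType) (g : T -> R) : (forall t, g t = 0) -> rsum g = 0.
Proof. by move=> g0; apply: big1 => t _. Qed.

Lemma rsum_const (T : finType) (a : R) : rsum (fun _ : T => a) = INR #|T| * a.
Proof.
rewrite /rsum big_const; elim: #|T| => [|k IH]; first by rewrite /=; ring.
by rewrite iterS IH S_INR; ring.
Qed.

Lemma rsum_split1 (T : finType) (g : T -> R) (t0 : T) :
  rsum g = g t0 + rsum (fun t => indic (t != t0) * g t).
Proof.
rewrite /rsum (bigD1 t0) //=; congr (_ + _).
by rewrite big_mkcond; apply: eq_bigr => t _; rewrite /indic; case: ifP => _; ring.
Qed.

Lemma rsum_eq1 (T : finType) (g : T -> R) (t0 : T) :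
  rsum (fun t => indic (t == t0) * g t) = g t0.
Proof.
rewrite (rsum_split1 _ t0) eqxx rsum0 /=; first by ring.
by move=> t; case: eqVneq => _ /=; ring.
Qed.

Lemma rsum_ge1 (T : finType) (g : T -> R) (t0 : T) :
  (forall t, 0 <= g t) -> g t0 <= rsum g.
Proof.
move=> g0; rewrite (rsum_split1 _ t0).
suff: 0 <= rsum (fun t => indic (t != t0) * g t) by lra.
by apply: rsum_ge0 => t; apply: Rmult_le_pos (indic_ge0 _) (g0 t).
Qed.

Lemma rsum_gt0_ex (T : finType) (g : T -> R) : 0 < rsum g -> exists t, 0 < g t.
Proof.
move=> g0; apply: NNPP => h.
suff : rsum g <= rsum (fun _ : T => 0) by rewrite rsum_const; lra.
apply: rsum_le => t; apply: Rnot_lt_le => gt; apply: h; by exists t.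
Qed.

Lemma rsum_reindex (S T : finType) (h : S -> T) (g : T -> R) :
  bijective h -> rsum g = rsum (fun s => g (h s)).
Proof. by move=> bij; rewrite /rsum (reindex h) //; apply: onW_bij. Qed.

Lemma rsum_indic_card (T : finType) (A : {set T}) :
  rsum (fun t => indic (t \in A)) = INR #|A|.
Proof.
rewrite /rsum /indic -big_mkcond /= -sum1_card.
by symmetry; apply: (big_morph INR) => // m k; exact: plus_INR.
Qed.

Lemma rprod_ext (T : finType) (g h : T -> R) :
  (forall t, g t = h t) -> rprod g = rprod h.
Proof. by move=> gh; apply: eq_bigr => t _. Qed.

Lemma rprod_ge0 (T : finType) (g : T -> R) : (forall t, 0 <= g t) -> 0 <= rprod g.
Proof.
move=> g0; apply: big_ind => [|a b|t _]; [lra|exact: Rmult_le_pos|exact: g0].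
Qed.

Lemma rprod_gt0 (T : finType) (g : T -> R) : (forall t, 0 < g t) -> 0 < rprod g.
Proof.
move=> g0; apply: big_ind => [|a b|t _]; [lra|exact: Rmult_lt_0_compat|exact: g0].
Qed.

Lemma rprodM (T : finType) (g h : T -> R) :
  rprod (fun t => g t * h t) = rprod g * rprod h.
Proof. exact: big_split. Qed.

Lemma rprod_split1 (T : finType) (g : T -> R) (t0 : T) :
  rprod g = g t0 * \big[Rmult/1]_(t | t != t0) g t.
Proof. by rewrite /rprod (bigD1 t0). Qed.

Lemma rprod_gt0_inv (T : finType) (g : T -> R) :
  (forall t, 0 <= g t) -> 0 < rprod g -> forall t, 0 < g t.
Proof.
move=> g0 + t; rewrite (rprod_split1 _ t) => h.
case: (g0 t) => // e; move: h; rewrite -e; lra.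
Qed.

Lemma rprod_const (T : finType) (a : R) : rprod (fun _ : T => a) = a ^ #|T|.
Proof.
rewrite /rprod big_const; elim: #|T| => [|k IH] //=; by rewrite IH.
Qed.

Lemma rprod_exp (T : finType) (g : T -> R) :
  rprod (fun t => exp (g t)) = exp (rsum g).
Proof.
symmetry; apply: (big_morph exp) => [x y|]; [exact: exp_plus|exact: exp_0].
Qed.

Lemma ln_rprod (T : finType) (g : T -> R) :
  (forall t, 0 < g t) -> ln (rprod g) = rsum (fun t => ln (g t)).
Proof.
move=> g0; rewrite -[RHS]ln_exp -rprod_exp; congr ln; apply: rprod_ext => t.
by rewrite exp_ln.
Qed.

Lemma rsum_rprod (J T : finType) (phi : J -> T -> R) :
  rsum (fun c : {ffun J -> T} => rprod (fun j => phi j (c j)))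
  = rprod (fun j => rsum (phi j)).
Proof. by rewrite /rprod bigA_distr_bigA. Qed.

Lemma rsum_ffun_pair (J S T : finType) (phi : {ffun J -> S} -> {ffun J -> T} -> R) :
  rsum (fun ss => rsum (fun ts => phi ss ts))
  = rsum (fun z : {ffun J -> S * T} => phi [ffun j => (z j).1] [ffun j => (z j).2]).
Proof.
rewrite rsum_pair.
rewrite (@rsum_reindex {ffun J -> S * T} _
  (fun z => ([ffun j => (z j).1], [ffun j => (z j).2]))) //.
exists (fun u : {ffun J -> S} * {ffun J -> T} => [ffun j => (u.1 j, u.2 j)]).
- by move=> z; apply/ffunP => j; rewrite !ffunE /=; case: (z j).
- by case=> a b; congr pair; apply/ffunP => j; rewrite !ffunE.
Qed.

Lemma rsum2_rprod (J S T : finType) (phi : J -> S -> T -> R) :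
  rsum (fun ss : {ffun J -> S} => rsum (fun ts : {ffun J -> T} =>
    rprod (fun j => phi j (ss j) (ts j))))
  = rprod (fun j => rsum (fun s => rsum (fun t => phi j s t))).
Proof.
rewrite rsum_ffun_pair.
rewrite (rsum_ext (h := fun z : {ffun J -> S * T} =>
  rprod (fun j => (fun j u => phi j u.1 u.2) j (z j)))); last first.
  by move=> z; apply: rprod_ext => j; rewrite !ffunE.
rewrite (rsum_rprod (fun j (u : S * T) => phi j u.1 u.2)).
by apply: rprod_ext => j; rewrite -rsum_pair.
Qed.

(** Derandomization. Weights of total less than 1 are allowed because a likelihood law with
    normalizer 0 is identically 0. *)
Lemma mean_le_value (T : finType) (t0 : T) (q g : T -> R) :
  (forall t, 0 <= q t) -> rsum q <= 1 -> (forall t, 0 <= g t) ->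
  exists t, rsum (fun t => q t * g t) <= g t.
Proof.
move=> q0 q1 g0; set m := rsum _.
apply: NNPP => h.
have gm t : g t < m by apply: Rnot_le_lt => hm; apply: h; exists t.
have m0 : 0 < m by apply: Rle_lt_trans (g0 t0) (gm t0).
have [t ht] : exists t, 0 < q t.
  have [t ht] := rsum_gt0_ex m0; exists t; case: (q0 t) => // e.
  by move: ht; rewrite -e; lra.
have : m < rsum q * m.
  rewrite rsumZr (rsum_split1 (fun u => q u * m) t) [X in X < _](rsum_split1 _ t).
  apply: Rplus_lt_le_compat; first exact: Rmult_lt_compat_l (gm t).
  apply: rsum_le => u; apply: Rmult_le_compat_l (indic_ge0 _) _.
  by apply: Rmult_le_compat_l (q0 u) (Rlt_le _ _ (gm u)).
nra.
Qed.

(** * Exponential decay for products of independent factors *)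

Lemma exp_ge1x (x : R) : 1 + x <= exp x.
Proof.
case: (Req_dec x 0) => [->|h]; first by rewrite exp_0; lra.
by apply: Rlt_le; exact: exp_ineq1.
Qed.

Lemma ln_le_sub1 (x : R) : 0 < x -> ln x <= x - 1.
Proof. by move=> x0; have := exp_ge1x (ln x); rewrite exp_ln //; lra. Qed.

(** From exp (-z) >= 1 - z, since (1 - z)(1 + z + 2 z^2) = 1 + z^2 (1 - 2 z) >= 1 in this range. *)
Lemma exp_le_quadratic (z : R) : z <= 1 / 2 -> exp z <= 1 + z + 2 * z ^ 2.
Proof.
move=> z2; have h := exp_ge1x (- z).
have e : exp z * exp (- z) = 1 by rewrite -exp_plus Rplus_opp_r exp_0.
have := exp_pos z; nra.
Qed.

(** The moment, as a function of s, has value 1 and derivative [mu - a < 0] at 0. The bound s <= 1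
    is what [Rmin1_exp_le] asks for. *)
Lemma exp_moment_lt (T : finType) (q u : T -> R) (a : R) :
  (forall t, 0 <= q t) -> rsum q = 1 -> rsum (fun t => q t * u t) < a ->
  exists s, 0 < s <= 1 /\ rsum (fun t => q t * exp (s * (u t - a))) < 1.
Proof.
move=> q0 q1; set mu := rsum _ => mua.
pose B := 1 + rsum (fun t => Rabs (u t)).
have uB t : Rabs (u t) <= B.
  have := @rsum_ge1 _ (fun t => Rabs (u t)) t (fun t => Rabs_pos _).
  rewrite /B; lra.
have B1 : 1 <= B.
  by rewrite /B; have := @rsum_ge0 _ (fun t => Rabs (u t)) (fun t => Rabs_pos _); lra.
(* The first term keeps s u <= 1/2, as the quadratic bound requires; the second makes the error 2
   s^2 B^2 at most half of the gain s (a - mu). *)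
pose s := Rmin (/ (2 * B)) ((a - mu) / (4 * B ^ 2)).
have B2 : 0 < 4 * B ^ 2 by nra.
have s0 : 0 < s.
  apply: Rmin_glb_lt; first by apply: Rinv_0_lt_compat; lra.
  by apply: Rdiv_lt_0_compat; lra.
have sB : s * B <= 1 / 2.
  have -> : 1 / 2 = / (2 * B) * B by field; lra.
  by apply: Rmult_le_compat_r; [lra|exact: Rmin_l].
have sBB : s * (4 * B ^ 2) <= a - mu.
  have -> : a - mu = (a - mu) / (4 * B ^ 2) * (4 * B ^ 2) by field; lra.
  by apply: Rmult_le_compat_r; [lra|exact: Rmin_r].
exists s; split; first by split=> //; nra.
have h : rsum (fun t => q t * exp (s * u t)) <= 1 + s * mu + 2 * s ^ 2 * B ^ 2.
  have -> : 1 + s * mu + 2 * s ^ 2 * B ^ 2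
      = rsum (fun t => q t * (1 + s * u t + 2 * s ^ 2 * B ^ 2)).
    rewrite (rsum_ext (h := fun t => (q t * (1 + 2 * s ^ 2 * B ^ 2) + s * (q t * u t))));
      last by move=> t; ring.
    by rewrite rsumD -rsumZr -rsumZl q1 -/mu; ring.
  apply: rsum_le => t; apply: Rmult_le_compat_l (q0 t) _.
  have [lo up] : - B <= u t <= B.
    by have := uB t; rewrite /Rabs; case: Rcase_abs => ?; lra.
  apply: Rle_trans (exp_le_quadratic _) _; first nra.
  have : (u t) ^ 2 <= B ^ 2 by nra.
  have := pow2_ge_0 s; nra.
have -> : rsum (fun t => q t * exp (s * (u t - a)))
    = rsum (fun t => q t * exp (s * u t)) * exp (- (s * a)).
  rewrite rsumZr; apply: rsum_ext => t.
  by rewrite Rmult_assoc -exp_plus; congr (_ * exp _); ring.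
have e : exp (s * a) * exp (- (s * a)) = 1 by rewrite -exp_plus Rplus_opp_r exp_0.
have e1 := exp_ge1x (s * a).
have e0 := exp_pos (- (s * a)).
rewrite -e; apply: Rmult_lt_compat_r => //; nra.
Qed.

Lemma Rmin1_exp_le (s x : R) : 0 < s <= 1 -> Rmin 1 (exp x) <= exp (s * x).
Proof.
move=> s1; case: (Rle_lt_dec 0 x) => x0.
  apply: Rle_trans (Rmin_l _ _) _; rewrite -exp_0.
  by case: (Req_dec 0 (s * x)) => [<-|h]; [lra|apply/Rlt_le/exp_increasing; nra].
apply: Rle_trans (Rmin_r _ _) _.
by case: (Req_dec x (s * x)) => [<-|h]; [lra|apply/Rlt_le/exp_increasing; nra].
Qed.

(** Chernoff's bound for the truncated mean in which the coding errors are expressed, instead of for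
    a tail probability: Rmin 1 (e^x) <= e^(s x) makes the summand a product over the places. Words
    of probability 0 contribute nothing, so [r] has to be positive only on the support of [q]. *)
Lemma product_tail (T : finType) (q r : T -> R) (a : R) :
  (forall t, 0 <= q t) -> rsum q = 1 -> (forall t, 0 < q t -> 0 < r t) ->
  rsum (fun t => q t * ln (r t)) < a ->
  exists rho, 0 <= rho < 1 /\ forall n,
    rsum (fun z : {ffun 'I_n -> T} => rprod (fun i => q (z i)) *
      Rmin 1 (exp (- (INR n * a)) * rprod (fun i => r (z i)))) <= rho ^ n.
Proof.
move=> q0 q1 r0 /(exp_moment_lt q0 q1) [s [s1 h]].
set rho := rsum _ in h; exists rho; split.
  by split=> //; apply: rsum_ge0 => t; apply: Rmult_le_pos (q0 t) (Rlt_le _ _ (exp_pos _)).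
move=> n.
have -> : rho ^ n = rsum (fun z : {ffun 'I_n -> T} =>
    rprod (fun i => q (z i) * exp (s * (ln (r (z i)) - a)))).
  rewrite (rsum_rprod (fun (i : 'I_n) t => q t * exp (s * (ln (r t) - a)))).
  by rewrite rprod_const card_ord.
apply: rsum_le => z; rewrite rprodM.
have := @rprod_ge0 'I_n (fun i => q (z i)) (fun i => q0 _).
case=> [|<-]; last lra.
set Q := rprod _ => Q0; apply: Rmult_le_compat_l; first lra.
have rz i : 0 < r (z i) by apply/r0/(rprod_gt0_inv _ Q0) => j; exact: q0.
have -> : exp (- (INR n * a)) * rprod (fun i => r (z i))
    = exp (rsum (fun i => ln (r (z i)) - a)).
  rewrite rsumB rsum_const card_ord -ln_rprod // /Rminus exp_plus exp_ln.
    by rewrite Rmult_comm.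
  exact: rprod_gt0.
rewrite rprod_exp -rsumZl; exact: Rmin1_exp_le.
Qed.

Lemma pow_eventually_lt (rho eps : R) :
  0 <= rho < 1 -> 0 < eps -> exists N : nat, forall n : nat, (N <= n)%nat -> rho ^ n < eps.
Proof.
move=> r1 e0; have [|N hN] := pow_lt_1_zero rho _ eps e0.
  by rewrite Rabs_pos_eq; lra.
exists N => n /leP /hN; rewrite Rabs_pos_eq //; by apply: pow_le; lra.
Qed.

(** * One-shot source coding with side information *)

Lemma codebook_mean1 (J C : finType) (q : C -> R) (j : J) (g : C -> R) :
  rsum q = 1 ->
  rsum (fun c : {ffun J -> C} => rprod (fun i => q (c i)) * g (c j))
  = rsum (fun v => q v * g v).
Proof.
move=> q1.
rewrite (rsum_ext (h := fun c : {ffun J -> C} =>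
  rprod (fun i => q (c i) * (if i == j then g (c i) else 1)))).
  rewrite (rsum_rprod (fun i v => q v * (if i == j then g v else 1))).
  rewrite (rprod_split1 _ j) eqxx big1 ?Rmult_1_r // => i /negbTE ->.
  by rewrite -[RHS]q1; apply: rsum_ext => v; ring.
move=> c; rewrite rprodM; congr (_ * _).
rewrite (rprod_split1 _ j) eqxx big1 ?Rmult_1_r // => i /negbTE -> //.
Qed.

Lemma codebook_mean2 (J C : finType) (q : C -> R) (j k : J) (g h : C -> R) :
  rsum q = 1 -> k != j ->
  rsum (fun c : {ffun J -> C} => rprod (fun i => q (c i)) * (g (c j) * h (c k)))
  = rsum (fun v => q v * g v) * rsum (fun v => q v * h v).
Proof.
move=> q1 kj.
rewrite (rsum_ext (h := fun c : {ffun J -> C} =>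
  rprod (fun i => q (c i) * (if i == j then g (c i) else if i == k then h (c i) else 1)))).
  rewrite (rsum_rprod (fun i v =>
    q v * (if i == j then g v else if i == k then h v else 1))).
  rewrite (rprod_split1 _ j) eqxx; congr (_ * _).
  rewrite (bigD1 k) //= (negbTE kj) eqxx big1 ?Rmult_1_r // => i.
  case/andP=> /negbTE -> /negbTE ->.
  by rewrite -[RHS]q1; apply: rsum_ext => v; ring.
move=> c; rewrite rprodM; congr (_ * _).
rewrite (rprod_split1 _ j) eqxx; congr (_ * _).
rewrite (bigD1 k) //= (negbTE kj) eqxx big1 ?Rmult_1_r // => i.
by case/andP=> /negbTE -> /negbTE ->.
Qed.

(* The tangent plane of the convex function 1/(ab) at (a0, b0). *)
Lemma inv_mul_tangent (a b a0 b0 : R) : 0 < a -> 0 < b -> 0 < a0 -> 0 < b0 ->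
  / (a0 * b0) * (3 - a / a0 - b / b0) <= / (a * b).
Proof.
move=> ha hb ha0 hb0.
have [s hs] : exists s, s = a / a0 by exists (a / a0).
have [t ht] : exists t, t = b / b0 by exists (b / b0).
have s0 : 0 < s by rewrite hs; exact: Rdiv_lt_0_compat.
have t0 : 0 < t by rewrite ht; exact: Rdiv_lt_0_compat.
have -> : / (a * b) = / (a0 * b0) * / (s * t).
  by rewrite hs ht; field; lra.
rewrite -hs -ht; apply: Rmult_le_compat_l.
  by apply/Rlt_le/Rinv_0_lt_compat; nra.
have st0 : 0 < s * t by nra.
(* With m = s + t, s t <= m^2 / 4 reduces the case m < 3 to (3 - m) m^2 <= 4, which is (m - 2)^2 (m
   + 1) >= 0. *)
suff : (3 - s - t) * (s * t) <= 1.
  move=> h; apply: (Rmult_le_reg_r (s * t)) => //.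
  by rewrite Rinv_l //; lra.
have h : 4 * (s * t) <= (s + t) ^ 2 by have := pow2_ge_0 (s - t); nra.
case: (Rle_lt_dec 3 (s + t)) => h3; first nra.
have : (3 - s - t) * (s + t) ^ 2 <= 4.
  have : 0 <= (s + t - 2) ^ 2 * (s + t + 1).
    by apply: Rmult_le_pos; [exact: pow2_ge_0|lra].
  nra.
nra.
Qed.

Lemma one_sub_Rmin_le (x : R) : 0 <= x -> 1 - Rmin 1 x <= / (1 + x).
Proof.
move=> x0; have h : (1 + x) * / (1 + x) = 1 by field; lra.
have i0 : 0 < / (1 + x) by apply: Rinv_0_lt_compat; lra.
by rewrite /Rmin; case: Rle_dec => h1; nra.
Qed.

(* For a random codebook c with i.i.d. entries of law q, the entry c j is
   recovered both by a likelihood test with scores r over all entries and by one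
   with scores s over the subset L. *)
Lemma likelihood_product_mean (J C : finType) (q r s : C -> R) (L : {set J}) (j : J) :
  (forall v, 0 <= q v) -> rsum q = 1 ->
  (forall v, 0 <= r v) -> (forall v, 0 <= s v) ->
  rsum (fun v => q v * r v) <= 1 -> rsum (fun v => q v * s v) <= 1 -> j \in L ->
  rsum (fun v => q v * (r v * s v / ((r v + INR #|J|) * (s v + (INR #|L| - 1)))))
  <= rsum (fun c : {ffun J -> C} => rprod (fun i => q (c i)) *
       (r (c j) / rsum (fun i => r (c i)) * (s (c j) / rsum (fun i => indic (i \in L) * s (c i))))).
Proof.
move=> q0 q1 r0 s0 qr qs jL.
(* Points of tangency: bounds on the means of the two normalizers given [c j = v], namely the score
   of v plus at most 1 per competitor. In [a] one extra unit keeps it positive; in [b] the count is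
   exact, so a row with one word costs nothing. *)
pose a v := r v + INR #|J|; pose b v := s v + (INR #|L| - 1).
have J1 : 1 <= INR #|J|.
  by rewrite -INR_1; apply/le_INR/leP; rewrite (cardD1 j).
have L1 : 1 <= INR #|L|.
  by rewrite -INR_1; apply/le_INR/leP; rewrite (cardD1 j) jL.
have a0 v : 0 < a v by rewrite /a; have := r0 v; lra.
pose G v := r v * s v / (a v * b v).
have G0 v : 0 <= G v.
  rewrite /G; case: (s0 v) => [h|<-]; last by rewrite Rmult_0_r /Rdiv Rmult_0_l; lra.
  apply: Rmult_le_pos; first by apply: Rmult_le_pos.
  apply/Rlt_le/Rinv_0_lt_compat/Rmult_lt_0_compat => //; rewrite /b; lra.
pose A (c : {ffun J -> C}) := rsum (fun i => r (c i)).
pose B (c : {ffun J -> C}) := rsum (fun i => indic (i \in L) * s (c i)).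
have wt0 (c : {ffun J -> C}) : 0 <= rprod (fun i => q (c i)) by apply: rprod_ge0.
(* On the tangent plane the mean is linear in the normalizers: each of the two subtracted terms has
   mean at most that of [G], so 3 - 1 - 1 = 1 copy of [G] remains. *)
apply: Rle_trans (_ : rsum (fun c : {ffun J -> C} => rprod (fun i => q (c i)) *
    (G (c j) * (3 - A c / a (c j) - B c / b (c j)))) <= _); last first.
  apply: rsum_le => c; apply: Rmult_le_compat_l => //.
  rewrite -/(A c) -/(B c) /G.
  case: (r0 (c j)) => [rp|<-]; last by rewrite /Rdiv !Rmult_0_l; lra.
  case: (s0 (c j)) => [sp|<-]; last by rewrite /Rdiv !(Rmult_0_r, Rmult_0_l); lra.
  have Ap : 0 < A c.
    by apply: Rlt_le_trans rp _; apply: (@rsum_ge1 _ (fun i => r (c i))).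
  have Bp : 0 < B c.
    apply: Rlt_le_trans sp _.
    have := @rsum_ge1 _ (fun i => indic (i \in L) * s (c i)) j.
    rewrite jL /= Rmult_1_l; apply=> i; apply: Rmult_le_pos (indic_ge0 _) (s0 _).
  have bp : 0 < b (c j) by rewrite /b; lra.
  have := inv_mul_tangent Ap Bp (a0 (c j)) bp => h.
  have -> : r (c j) / A c * (s (c j) / B c) = r (c j) * s (c j) * / (A c * B c).
    by field; lra.
  rewrite /Rdiv [X in X <= _]Rmult_assoc; apply: Rmult_le_compat_l; last exact: h.
  by apply: Rmult_le_pos.
have mA : rsum (fun c : {ffun J -> C} => rprod (fun i => q (c i)) *
    (G (c j) * (A c / a (c j)))) <= rsum (fun v => q v * G v).
  rewrite (rsum_ext (h := fun c : {ffun J -> C} =>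
    rprod (fun i => q (c i)) * (G (c j) * (r (c j) / a (c j))) +
    rsum (fun i => indic (i != j) * (rprod (fun i => q (c i)) * (G (c j) / a (c j) * r (c i)))))).
    rewrite rsumD (codebook_mean1 j (fun v => G v * (r v / a v))) // rsum_exch.
    apply: Rle_trans (_ : rsum (fun v => q v * (G v * (r v / a v))) +
        rsum (fun i : J => rsum (fun v => q v * (G v / a v))) <= _).
      apply: Rplus_le_compat_l; apply: rsum_le => i.
      have g0 : 0 <= rsum (fun v => q v * (G v / a v)).
        apply: rsum_ge0 => v; apply: Rmult_le_pos => //.
        by apply: Rmult_le_pos => //; apply/Rlt_le/Rinv_0_lt_compat.
      rewrite -rsumZl; case: (boolP (i == j)) => [_|ij] /=; first lra.
      rewrite (codebook_mean2 (fun v => G v / a v) r) //; nra.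
    rewrite rsum_const rsumZl -rsumD; apply: rsum_le => v.
    apply: Req_le; rewrite /a; field; have := a0 v; rewrite /a; lra.
  move=> c; rewrite {1}/A (rsum_split1 _ j) /Rdiv Rmult_plus_distr_r.
  rewrite Rmult_plus_distr_l Rmult_plus_distr_l; congr (_ + _).
  by rewrite rsumZr !rsumZl; apply: rsum_ext => i; ring.
have mB : rsum (fun c : {ffun J -> C} => rprod (fun i => q (c i)) *
    (G (c j) * (B c / b (c j)))) <= rsum (fun v => q v * G v).
  rewrite (rsum_ext (h := fun c : {ffun J -> C} =>
    rprod (fun i => q (c i)) * (G (c j) * (s (c j) / b (c j))) +
    rsum (fun i => indic (i != j) * indic (i \in L) *
      (rprod (fun i => q (c i)) * (G (c j) / b (c j) * s (c i)))))).
    rewrite rsumD (codebook_mean1 j (fun v => G v * (s v / b v))) // rsum_exch.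
    apply: Rle_trans (_ : rsum (fun v => q v * (G v * (s v / b v))) +
        rsum (fun i : J => indic (i \in L :\ j) * rsum (fun v => q v * (G v / b v))) <= _).
      apply: Rplus_le_compat_l; apply: rsum_le => i.
      have g0 : 0 <= rsum (fun v => q v * (G v / b v)).
        apply: rsum_ge0 => v; apply: Rmult_le_pos => //.
        rewrite /G /Rdiv; case: (s0 v) => [h|<-].
          apply: Rmult_le_pos (G0 v) _.
          by apply/Rlt_le/Rinv_0_lt_compat; rewrite /b; lra.
        by rewrite !(Rmult_0_r, Rmult_0_l); lra.
      rewrite -rsumZl in_setD1; case: (boolP (i == j)) => [_|ij] /=; first lra.
      rewrite (codebook_mean2 (fun v => G v / b v) s) //.
      case: (i \in L) => /=; nra.
    rewrite -rsumZr rsum_indic_card rsumZl -rsumD; apply: rsum_le => v.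
    have -> : INR #|L :\ j| = INR #|L| - 1.
      by rewrite (cardsD1 j L) jL plus_INR /=; ring.
    rewrite /G; case: (s0 v) => [h|<-]; last by rewrite /Rdiv !(Rmult_0_r, Rmult_0_l); lra.
    by apply: Req_le; rewrite /b; field; have := a0 v; lra.
  move=> c; rewrite {1}/B (rsum_split1 _ j) jL /= Rmult_1_l /Rdiv Rmult_plus_distr_r.
  rewrite Rmult_plus_distr_l Rmult_plus_distr_l; congr (_ + _).
  by rewrite rsumZr !rsumZl; apply: rsum_ext => i; ring.
rewrite (rsum_ext (g := fun c : {ffun J -> C} => rprod (fun i => q (c i)) *
    (G (c j) * (3 - A c / a (c j) - B c / b (c j))))
  (h := fun c : {ffun J -> C} => 3 * (rprod (fun i => q (c i)) * G (c j)) -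
    rprod (fun i => q (c i)) * (G (c j) * (A c / a (c j))) -
    rprod (fun i => q (c i)) * (G (c j) * (B c / b (c j))))); last by move=> c; ring.
rewrite !rsumB -rsumZl (codebook_mean1 j G) //.
have -> : rsum (fun v => q v * (r v * s v / ((r v + INR #|J|) * (s v + (INR #|L| - 1)))))
  = rsum (fun v => q v * G v) by [].
have h3 (x y z : R) : y <= x -> z <= x -> x <= 3 * x - y - z by lra.
exact: h3 mA mB.
Qed.

(** * Likelihood ratios of a channel and the one-shot code *)

Definition outY (A B C : finType) (p : A -> B -> R) (w : C -> A -> R) (c : C) (b : B) : R :=
  rsum (fun a => p a b * w c a).

Definition out_law (A B C : finType) (p : A -> B -> R) (w : C -> A -> R) (c : C) : R :=
  rsum (fun b => outY p w c b).

(** The density of the joint law of C and A against the product of the marginals; [ratioY] is the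
    same for C and B. The means of their logarithms are I(C;A) and I(C;B) in nats. *)
Definition ratioX (A B C : finType) (p : A -> B -> R) (w : C -> A -> R) (c : C) (a : A) : R :=
  w c a / out_law p w c.

Definition ratioY (A B C : finType) (p : A -> B -> R) (w : C -> A -> R) (c : C) (b : B) : R :=
  outY p w c b / (out_law p w c * pY p b).

Lemma Rdiv_ge0 (x y : R) : 0 <= x -> 0 <= y -> 0 <= x / y.
Proof.
move=> x0 [y0|<-]; last by rewrite /Rdiv Rinv_0; lra.
by apply: Rmult_le_pos => //; apply/Rlt_le/Rinv_0_lt_compat.
Qed.

Lemma Rmul_div_cancel_le (x y : R) : 0 <= x -> 0 <= y -> y * (x / y) <= x.
Proof.
move=> x0 [y0|<-]; last by lra.
by apply: Req_le; field; lra.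
Qed.

Lemma outY_ge0 (A B C : finType) (p : A -> B -> R) (w : C -> A -> R) (c : C) (b : B) :
  (forall a b, 0 <= p a b) -> (forall c a, 0 <= w c a) -> 0 <= outY p w c b.
Proof. by move=> p0 w0; apply: rsum_ge0 => a; apply: Rmult_le_pos. Qed.

Lemma out_law_ge0 (A B C : finType) (p : A -> B -> R) (w : C -> A -> R) (c : C) :
  (forall a b, 0 <= p a b) -> (forall c a, 0 <= w c a) -> 0 <= out_law p w c.
Proof. by move=> p0 w0; apply: rsum_ge0 => b; apply: outY_ge0. Qed.

Lemma outY_gt0 (A B C : finType) (p : A -> B -> R) (w : C -> A -> R) (c : C) (a : A) (b : B) :
  (forall a b, 0 <= p a b) -> (forall c a, 0 <= w c a) ->
  0 < p a b * w c a -> 0 < outY p w c b.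
Proof.
move=> p0 w0 h; apply: Rlt_le_trans h _.
by apply: (@rsum_ge1 _ (fun a => p a b * w c a)) => a'; apply: Rmult_le_pos.
Qed.

Lemma out_law_gt0 (A B C : finType) (p : A -> B -> R) (w : C -> A -> R) (c : C) (a : A) (b : B) :
  (forall a b, 0 <= p a b) -> (forall c a, 0 <= w c a) ->
  0 < p a b * w c a -> 0 < out_law p w c.
Proof.
move=> p0 w0 h; apply: Rlt_le_trans (outY_gt0 p0 w0 h) _.
by apply: (@rsum_ge1 _ (outY p w c)) => b'; apply: outY_ge0.
Qed.

Lemma pY_gt0 (A B : finType) (p : A -> B -> R) (a : A) (b : B) :
  (forall a b, 0 <= p a b) -> 0 < p a b -> 0 < pY p b.
Proof.
move=> p0 h; apply: Rlt_le_trans h _.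
by apply: (@rsum_ge1 _ (fun a => p a b)) => a'.
Qed.

Lemma pY_ge0 (A B : finType) (p : A -> B -> R) (b : B) :
  (forall a b, 0 <= p a b) -> 0 <= pY p b.
Proof. by move=> p0; apply: rsum_ge0. Qed.

Lemma sum_outY (A B C : finType) (p : A -> B -> R) (w : C -> A -> R) (b : B) :
  (forall a, rsum (fun c => w c a) = 1) -> rsum (fun c => outY p w c b) = pY p b.
Proof.
move=> w1; rewrite rsum_exch; apply: rsum_ext => a.
by rewrite -rsumZl w1 Rmult_1_r.
Qed.

Lemma sum_out_law (A B C : finType) (p : A -> B -> R) (w : C -> A -> R) :
  is_pmf p -> (forall a, rsum (fun c => w c a) = 1) -> rsum (out_law p w) = 1.
Proof.
move=> [p0 p1] w1; rewrite rsum_exch.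
rewrite (rsum_ext (h := pY p)) => [|b]; last exact: sum_outY.
by rewrite -[RHS]p1 rsum_exch.
Qed.

Lemma card_fst_fiber (S T : finType) (s : S) : #|[set i : S * T | i.1 == s]| = #|T|.
Proof.
rewrite -[RHS]mul1n -(cards1 s) -[#|T|]cardsT -cardsX.
by apply: eq_card => i; rewrite !inE andbT.
Qed.

(* Encoder and decoder both draw codewords at random, proportionally to their
   likelihood. *)
Lemma random_codebook_exists (A B C : finType) (p : A -> B -> R) (w : C -> A -> R)
    (M k : nat) :
  is_pmf p -> (forall c a, 0 <= w c a) -> (forall a, rsum (fun c => w c a) = 1) ->
  (0 < M)%nat ->
  exists c : {ffun 'I_M * 'I_k.+1 -> C},
    rsum (fun a => rsum (fun b => rsum (fun v => p a b * w v a *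
      (1 - Rmin 1 (ratioX p w v a / (INR M * INR k.+1)) - Rmin 1 (INR k / ratioY p w v b)))))
    <= rsum (fun a => rsum (fun b => p a b * rsum (fun j =>
         ratioX p w (c j) a / rsum (fun i => ratioX p w (c i) a) *
         (ratioY p w (c j) b /
          rsum (fun i => indic (i \in [set i | i.1 == j.1]) * ratioY p w (c i) b))))).
Proof.
move=> pmf w0 w1 M0; have [p0 p1] := pmf.
pose J : finType := ('I_M * 'I_k.+1)%type.
pose q := out_law p w.
have q0 v : 0 <= q v by exact: out_law_ge0.
have q1 : rsum q = 1 by exact: sum_out_law.
have rX0 v a : 0 <= ratioX p w v a by apply: Rdiv_ge0 => //; apply: q0.
have rY0 v b : 0 <= ratioY p w v b.
  apply: Rdiv_ge0; first exact: outY_ge0.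
  by apply: Rmult_le_pos (q0 v) (pY_ge0 _ _).
pose wt (c : {ffun J -> C}) := rprod (fun i => q (c i)).
have wt0 c : 0 <= wt c by apply: rprod_ge0.
have wt1 : rsum wt = 1.
  by rewrite (rsum_rprod (fun (i : J) v => q v)) q1 rprod_const pow1.
pose ED (c : {ffun J -> C}) a b j := ratioX p w (c j) a / rsum (fun i => ratioX p w (c i) a) *
         (ratioY p w (c j) b /
          rsum (fun i : J => indic (i \in [set i : J | i.1 == j.1]) * ratioY p w (c i) b)).
have ED0 c a b j : 0 <= ED c a b j.
  apply: Rmult_le_pos; apply: Rdiv_ge0 => //; apply: rsum_ge0 => i //.
  by apply: Rmult_le_pos (indic_ge0 _) _.
pose val c := rsum (fun a => rsum (fun b => p a b * rsum (ED c a b))).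
have val0 c : 0 <= val c.
  apply: rsum_ge0 => a; apply: rsum_ge0 => b; apply: Rmult_le_pos => //.
  exact: rsum_ge0.
have [c0 _] : exists c, 0 < wt c by apply: rsum_gt0_ex; rewrite wt1; lra.
have [c hc] := mean_le_value c0 wt0 (Req_le _ _ wt1) val0.
exists c; apply: Rle_trans hc.
have -> : rsum (fun c => wt c * val c) = rsum (fun a => rsum (fun b =>
    rsum (fun j => p a b * rsum (fun c => wt c * ED c a b j)))).
  rewrite (rsum_ext (h := fun c => rsum (fun a => rsum (fun b => rsum (fun j =>
    wt c * (p a b * ED c a b j)))))); last first.
    move=> c'; rewrite rsumZl; apply: rsum_ext => a; rewrite rsumZl.
    by apply: rsum_ext => b; rewrite rsumZl rsumZl.
  rewrite rsum_exch; apply: rsum_ext => a; rewrite rsum_exch; apply: rsum_ext => b.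
  rewrite rsum_exch; apply: rsum_ext => j; rewrite rsumZl; apply: rsum_ext => c'.
  ring.
apply: rsum_le => a; apply: rsum_le => b.
have M1 : 1 <= INR M by rewrite -INR_1; apply/le_INR/leP.
have k0 : 0 <= INR k by exact: pos_INR.
pose N := INR M * INR k.+1.
have NE : N = INR #|J| by rewrite card_prod !card_ord mult_INR.
have N0 : 0 < N by rewrite /N S_INR; nra.
(* The N entries of the codebook are exchangeable, so each is charged an N-th part of the bound. *)
rewrite -/N (_ : rsum (fun v => _) = rsum (fun j : J => rsum (fun v => p a b * w v a *
      (1 - Rmin 1 (ratioX p w v a / N) - Rmin 1 (INR k / ratioY p w v b))) / N)); last first.
  by rewrite rsum_const -NE; field; lra.
apply: rsum_le => j.
case: (p0 a b) => [pab|<-]; last first.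
  rewrite rsum0 ?/Rdiv ?Rmult_0_l; [lra|move=> v; ring].
have hX : rsum (fun v => q v * ratioX p w v a) <= 1.
  rewrite -(w1 a); apply: rsum_le => v; exact: Rmul_div_cancel_le.
have hY : rsum (fun v => q v * ratioY p w v b) <= 1.
  have pb := pY_gt0 p0 pab.
  apply: Rle_trans (_ : rsum (fun v => outY p w v b * / pY p b) <= _); last first.
    by rewrite -rsumZr sum_outY // Rinv_r; lra.
  apply: rsum_le => v.
  have -> : ratioY p w v b = outY p w v b * / pY p b / q v.
    by rewrite /ratioY -/q /Rdiv Rinv_mult; ring.
  apply: Rmul_div_cancel_le (q0 v).
  by apply: Rdiv_ge0; [exact: outY_ge0|lra].
have jL : j \in [set i : J | i.1 == j.1] by rewrite inE.
have := likelihood_product_mean q0 q1 (rX0^~ a) (rY0^~ b) hX hY jL.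
rewrite card_fst_fiber card_ord -NE S_INR => h.
apply: Rle_trans (Rmult_le_compat_l _ _ _ (Rlt_le _ _ pab) h).
rewrite /Rdiv rsumZr rsumZl; apply: rsum_le => v.
have -> : INR k + 1 - 1 = INR k by ring.
have rX := rX0 v a; have rY := rY0 v b.
case: (w0 v a) => [wa|<-]; last first.
  rewrite !(Rmult_0_r, Rmult_0_l); apply: Rmult_le_pos; first lra.
  apply: Rmult_le_pos => //; apply: (@Rdiv_ge0 (_ * _)); apply: Rmult_le_pos; lra.
have pw : 0 < p a b * w v a by nra.
have qv : 0 < q v by exact: out_law_gt0 pw.
have rXp : 0 < ratioX p w v a by exact: Rdiv_lt_0_compat.
have rYp : 0 < ratioY p w v b.
  apply: Rdiv_lt_0_compat; first exact: outY_gt0 pw.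
  by apply: Rmult_lt_0_compat qv (pY_gt0 p0 pab).
have wE : w v a = q v * ratioX p w v a by rewrite /ratioX -/q; field; lra.
have h1 := one_sub_Rmin_le (Rdiv_ge0 rX (Rlt_le _ _ N0)).
have h2 := one_sub_Rmin_le (Rdiv_ge0 k0 rY).
rewrite {1}wE.
move: h1 h2 rXp rYp; move: (ratioX p w v a) (ratioY p w v b) => x y h1 h2 x0 y0.
have m1 := Rmin_l 1 (x / N); have m2 := Rmin_l 1 (INR k / y).
have n1 : 0 <= Rmin 1 (x / N).
  by apply: Rmin_glb; [lra|apply: Rdiv_ge0; lra].
have n2 : 0 <= Rmin 1 (INR k / y).
  by apply: Rmin_glb; [lra|apply: Rdiv_ge0; lra].
(* Dividing by N and by y brings both factors to the form 1 / (1 + t) of [one_sub_Rmin_le]; then (1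
   - s)(1 - t) >= 1 - s - t. *)
have -> : p a b * (q v * (x * y * / ((x + N) * (y + INR k))))
    = p a b * q v * x * / N * (/ (1 + x / N) * / (1 + INR k / y)).
  field; repeat split; nra.
have -> : p a b * (q v * x) * (1 - Rmin 1 (x * / N) - Rmin 1 (INR k * / y)) * / N
    = p a b * q v * x * / N * (1 - Rmin 1 (x / N) - Rmin 1 (INR k / y)).
  by rewrite /Rdiv; ring.
apply: Rmult_le_compat_l; last first.
  apply: Rle_trans (Rmult_le_compat _ _ _ _ _ _ h1 h2); nra.
apply: (@Rdiv_ge0 (_ * _)); last lra.
by apply: Rmult_le_pos; [apply: Rmult_le_pos|]; lra.
Qed.

(** Each random pick is replaced by a best one: for every a in the encoder, then, with the encoder
    fixed, for every row and b in the decoder. Success only asks that the decoded word have positive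
    [w] given a, since such words determine f. *)
Lemma one_shot_side_information (A B C : finType) (p : A -> B -> R) (w : C -> A -> R)
    (M k : nat) :
  is_pmf p -> (forall c a, 0 <= w c a) -> (forall a, rsum (fun c => w c a) = 1) ->
  (0 < M)%nat ->
  exists (enc : A -> 'I_M) (dec : 'I_M -> B -> C),
    rsum (fun a => rsum (fun b => rsum (fun v => p a b * w v a *
      (1 - Rmin 1 (ratioX p w v a / (INR M * INR k.+1)) - Rmin 1 (INR k / ratioY p w v b)))))
    <= rsum (fun a => rsum (fun b => indic (posb (w (dec (enc a) b) a)) * p a b)).
Proof.
move=> pmf w0 w1 M0; have [p0 _] := pmf.
have [c hc] := random_codebook_exists k pmf w0 w1 M0.
pose J : finType := ('I_M * 'I_k.+1)%type.
have q0 v : 0 <= out_law p w v by exact: out_law_ge0.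
have rX0 v a : 0 <= ratioX p w v a by apply: Rdiv_ge0.
have rY0 v b : 0 <= ratioY p w v b.
  apply: Rdiv_ge0; first exact: outY_ge0.
  by apply: Rmult_le_pos (q0 v) (pY_ge0 _ _).
pose E a (j : J) := ratioX p w (c j) a / rsum (fun i => ratioX p w (c i) a).
pose SY b (m : 'I_M) := rsum (fun i : J => indic (i \in [set i : J | i.1 == m]) * ratioY p w (c i) b).
pose D b (j : J) := ratioY p w (c j) b / SY b j.1.
have SY0 b m : 0 <= SY b m.
  by apply: rsum_ge0 => i; apply: Rmult_le_pos (indic_ge0 _) _.
have D0 b j : 0 <= D b j by apply: Rdiv_ge0.
have E0 a j : 0 <= E a j by apply: Rdiv_ge0 => //; apply: rsum_ge0.
have div1 x : x / x <= 1.
  case: (Req_dec x 0) => [->|h]; first by rewrite /Rdiv Rmult_0_l; lra.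
  by apply: Req_le; field.
have E1 a : rsum (E a) <= 1 by rewrite /E /Rdiv -rsumZr; exact: div1.
have D1 b m : rsum (fun l => D b (m, l)) <= 1.
  rewrite /D /Rdiv /= -rsumZr.
  suff -> : rsum (fun l => ratioY p w (c (m, l)) b) = SY b m by exact: div1.
  rewrite /SY rsum_prod.
  rewrite -[LHS](rsum_eq1 (fun i => rsum (fun l => ratioY p w (c (i, l)) b)) m).
  apply: rsum_ext => i; rewrite rsumZl; apply: rsum_ext => l.
  by rewrite inE.
(* The random encoder never picks a word with [w = 0], so this factor is free in its mean; in the
   optimized choice it makes success imply compatibility with a. *)
pose ok a (j : J) := indic (posb (w (c j) a)).
have [enc henc] : exists enc : A -> J, forall a,
    rsum (fun j => E a j * (ok a j * rsum (fun b => p a b * D b j)))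
    <= ok a (enc a) * rsum (fun b => p a b * D b (enc a)).
  apply: (fin_all_exists (P := fun a j' => rsum (fun j => E a j * (ok a j *
    rsum (fun b => p a b * D b j))) <= ok a j' * rsum (fun b => p a b * D b j'))) => a.
  apply: (mean_le_value (Ordinal M0, ord0)) => // j.
  apply: Rmult_le_pos (indic_ge0 _) _; apply: rsum_ge0 => b; exact: Rmult_le_pos.
have [dec hdec] : exists dec : 'I_M * B -> 'I_k.+1, forall mb,
    rsum (fun l => D mb.2 (mb.1, l) *
      rsum (fun a => indic (enc a == (mb.1, l)) * (ok a (mb.1, l) * p a mb.2)))
    <= rsum (fun a => indic (enc a == (mb.1, dec mb)) * (ok a (mb.1, dec mb) * p a mb.2)).
  apply: (fin_all_exists (P := fun mb l' => rsum (fun l => D mb.2 (mb.1, l) *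
      rsum (fun a => indic (enc a == (mb.1, l)) * (ok a (mb.1, l) * p a mb.2)))
    <= rsum (fun a => indic (enc a == (mb.1, l')) * (ok a (mb.1, l') * p a mb.2)))) => mb.
  apply: (mean_le_value ord0) => // l; apply: rsum_ge0 => a.
  by apply: Rmult_le_pos (indic_ge0 _) (Rmult_le_pos _ _ (indic_ge0 _) _).
exists (fun a => (enc a).1), (fun m b => c (m, dec (m, b))).
apply: Rle_trans hc _.
apply: Rle_trans (_ : rsum (fun a => ok a (enc a) * rsum (fun b => p a b * D b (enc a))) <= _).
  apply: rsum_le => a; apply: Rle_trans (henc a); apply: Req_le.
  rewrite (rsum_ext (h := fun b => rsum (fun j => p a b * (E a j * D b j)))); last first.
    by move=> b; rewrite rsumZl.
  rewrite rsum_exch; apply: rsum_ext => j; rewrite !rsumZl; apply: rsum_ext => b.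
  rewrite /ok; case: posbP => [_|h] /=; first by ring.
  have -> : E a j = 0; last by ring.
  have h0 : w (c j) a = 0 by have := w0 (c j) a; lra.
  by rewrite /E /ratioX h0 /Rdiv !Rmult_0_l.
rewrite [X in _ <= X]rsum_exch.
have -> : rsum (fun a => ok a (enc a) * rsum (fun b => p a b * D b (enc a)))
  = rsum (fun b => rsum (fun m => rsum (fun l => D b (m, l) *
      rsum (fun a => indic (enc a == (m, l)) * (ok a (m, l) * p a b))))).
  rewrite (rsum_ext (h := fun a => rsum (fun b => ok a (enc a) * (p a b * D b (enc a)))));
    last by move=> a; rewrite rsumZl.
  rewrite rsum_exch; apply: rsum_ext => b.
  rewrite (rsum_pair (fun m l => D b (m, l) *
      rsum (fun a => indic (enc a == (m, l)) * (ok a (m, l) * p a b)))).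
  rewrite (rsum_ext (h := fun a => rsum (fun j : J =>
    indic (j == enc a) * (ok a j * (p a b * D b j))))); last first.
    by move=> a; rewrite (rsum_eq1 (fun j => ok a j * (p a b * D b j))).
  rewrite rsum_exch; apply: rsum_ext => -[m l] /=; rewrite rsumZl; apply: rsum_ext => a.
  by rewrite eq_sym; ring.
apply: rsum_le => b.
apply: Rle_trans (rsum_le (fun m => hdec (m, b))) _ => /=.
rewrite rsum_exch; apply: rsum_le => a.
rewrite -[X in _ <= X](rsum_eq1 (fun m => indic (posb (w (c (m, dec (m, b))) a)) * p a b)).
apply: rsum_le => m; apply: Rmult_le_compat_r.
  by apply: Rmult_le_pos (indic_ge0 _) _.
case: eqP => [->|_] /=; last exact: indic_ge0.
by rewrite eqxx /=; lra.
Qed.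

(** * Memoryless sources *)

Lemma msgs_bounds (n : nat) (r : R) :
  Rpower 2 (INR n * r) - 1 < INR (msgs n r) <= Rpower 2 (INR n * r).
Proof.
rewrite /msgs; set x := Rpower _ _.
have x0 : 0 < x by exact: exp_pos.
have [h1 h2] := archimed x.
have u1 : (0 < up x)%Z by apply: lt_IZR; lra.
have -> : INR (Z.to_nat (up x - 1)) = IZR (up x) - 1.
  by rewrite INR_IZR_INZ Z2Nat.id ?minus_IZR //; lia.
lra.
Qed.

Lemma msgs_gt0 (n : nat) (r : R) : 0 <= r -> (0 < msgs n r)%nat.
Proof.
move=> r0; have [h _] := msgs_bounds n r.
have x1 : 1 <= Rpower 2 (INR n * r).
  rewrite -(Rpower_O 2); last lra.
  by apply: Rle_Rpower; [lra|apply: Rmult_le_pos => //; exact: pos_INR].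
by apply/ltP/INR_lt; rewrite /=; lra.
Qed.

(** A floor that is at least 1 is more than half of its argument. The factor 2 is later absorbed by
    [Rmin1_scale_le]. *)
Lemma msgs_ge_half (n : nat) (r : R) :
  0 <= r -> exp (INR n * (r * ln 2)) / 2 <= INR (msgs n r).
Proof.
move=> r0; have [h _] := msgs_bounds n r.
have : 1 <= INR (msgs n r) by rewrite -INR_1; apply/le_INR/ltP/msgs_gt0.
move: h; rewrite /Rpower Rmult_assoc; lra.
Qed.

Lemma rprod_div (T : finType) (g h : T -> R) :
  rprod (fun t => g t / h t) = rprod g / rprod h.
Proof.
rewrite rprodM; congr (_ * _).
rewrite /rprod; apply: (big_ind2 (fun x y => x = / y)) => // [|a b c d -> ->].
  by rewrite Rinv_1.
by rewrite Rinv_mult.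
Qed.

Definition chn (X V : finType) (w : V -> X -> R) (n : nat)
  (vs : {ffun 'I_n -> V}) (xs : {ffun 'I_n -> X}) : R :=
  rprod (fun i => w (vs i) (xs i)).

Lemma Pn_ge0 (X Y : finType) (p : X -> Y -> R) (n : nat) xs ys :
  (forall x y, 0 <= p x y) -> 0 <= @Pn X Y p n xs ys.
Proof. by move=> p0; apply: (@rprod_ge0 _ (fun i => p (xs i) (ys i))). Qed.

Lemma Pn_pmf (X Y : finType) (p : X -> Y -> R) (n : nat) :
  is_pmf p -> is_pmf (@Pn X Y p n).
Proof.
move=> [p0 p1]; split; first by move=> xs ys; apply: Pn_ge0.
rewrite (rsum2_rprod (fun (i : 'I_n) x y => p x y)) p1 rprod_const.
exact: pow1.
Qed.

Lemma Pn_gt0_inv (X Y : finType) (p : X -> Y -> R) (n : nat) xs ys :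
  (forall x y, 0 <= p x y) -> 0 < @Pn X Y p n xs ys -> forall i, 0 < p (xs i) (ys i).
Proof. by move=> p0 h i; apply: (@rprod_gt0_inv _ (fun i => p (xs i) (ys i))). Qed.

Lemma chn_sum1 (X V : finType) (w : V -> X -> R) (n : nat) (xs : {ffun 'I_n -> X}) :
  (forall x, rsum (fun v => w v x) = 1) -> rsum (fun vs => chn w vs xs) = 1.
Proof.
move=> w1; rewrite (rsum_rprod (fun i v => w v (xs i))).
by rewrite (rprod_ext (h := fun _ => 1)) // rprod_const pow1.
Qed.

Lemma outY_Pn (X Y V : finType) (p : X -> Y -> R) (w : V -> X -> R) (n : nat)
    (vs : {ffun 'I_n -> V}) (ys : {ffun 'I_n -> Y}) :
  outY (@Pn X Y p n) (@chn X V w n) vs ys = rprod (fun i => outY p w (vs i) (ys i)).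
Proof.
rewrite -(rsum_rprod (fun i x => p x (ys i) * w (vs i) x)).
by apply: rsum_ext => xs; rewrite rprodM.
Qed.

Lemma out_law_Pn (X Y V : finType) (p : X -> Y -> R) (w : V -> X -> R) (n : nat)
    (vs : {ffun 'I_n -> V}) :
  out_law (@Pn X Y p n) (@chn X V w n) vs = rprod (fun i => out_law p w (vs i)).
Proof.
rewrite -(rsum_rprod (fun i y => outY p w (vs i) y)).
by apply: rsum_ext => ys; exact: outY_Pn.
Qed.

Lemma pY_Pn (X Y : finType) (p : X -> Y -> R) (n : nat) (ys : {ffun 'I_n -> Y}) :
  pY (@Pn X Y p n) ys = rprod (fun i => pY p (ys i)).
Proof. exact: (rsum_rprod (fun i x => p x (ys i))). Qed.

Lemma ratioX_Pn (X Y V : finType) (p : X -> Y -> R) (w : V -> X -> R) (n : nat)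
    (vs : {ffun 'I_n -> V}) (xs : {ffun 'I_n -> X}) :
  ratioX (@Pn X Y p n) (@chn X V w n) vs xs = rprod (fun i => ratioX p w (vs i) (xs i)).
Proof. by rewrite /ratioX out_law_Pn rprod_div. Qed.

Lemma ratioY_Pn (X Y V : finType) (p : X -> Y -> R) (w : V -> X -> R) (n : nat)
    (vs : {ffun 'I_n -> V}) (ys : {ffun 'I_n -> Y}) :
  ratioY (@Pn X Y p n) (@chn X V w n) vs ys = rprod (fun i => ratioY p w (vs i) (ys i)).
Proof. by rewrite /ratioY outY_Pn out_law_Pn pY_Pn rprod_div rprodM. Qed.

Lemma source_channel_tail (X Y V : finType) (p : X -> Y -> R) (w : V -> X -> R)
    (r : X -> Y -> V -> R) (a : R) :
  is_pmf p -> (forall v x, 0 <= w v x) -> (forall x, rsum (fun v => w v x) = 1) ->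
  (forall x y v, 0 < p x y * w v x -> 0 < r x y v) ->
  rsum (fun x => rsum (fun y => rsum (fun v => p x y * w v x * ln (r x y v)))) < a ->
  exists rho, 0 <= rho < 1 /\ forall n,
    rsum (fun xs => rsum (fun ys => rsum (fun vs => @Pn X Y p n xs ys * chn w vs xs *
      Rmin 1 (exp (- (INR n * a)) * rprod (fun i => r (xs i) (ys i) (vs i)))))) <= rho ^ n.
Proof.
move=> [p0 p1] w0 w1 r0 ha.
have [||||rho [rho1 h]] := @product_tail (X * Y * V)%type
  (fun z => p z.1.1 z.1.2 * w z.2 z.1.1) (fun z => r z.1.1 z.1.2 z.2) a.
- by move=> z; apply: Rmult_le_pos.
- rewrite !rsum_prod /= -[RHS]p1; apply: rsum_ext => x; apply: rsum_ext => y.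
  by rewrite -rsumZl w1 Rmult_1_r.
- by move=> z; exact: r0.
- by rewrite !rsum_prod.
exists rho; split=> // n; apply: Rle_trans (h n); apply: Req_le.
rewrite (rsum_ffun_pair (fun xs ys => rsum (fun vs => Pn p xs ys * chn w vs xs *
      Rmin 1 (exp (- (INR n * a)) * rprod (fun i => r (xs i) (ys i) (vs i)))))).
rewrite (rsum_ffun_pair (fun zs vs => Pn p [ffun j => (zs j).1] [ffun j => (zs j).2] *
      chn w vs [ffun j => (zs j).1] *
      Rmin 1 (exp (- (INR n * a)) * rprod (fun i =>
        r ([ffun j => (zs j).1] i) ([ffun j => (zs j).2] i) (vs i))))).
apply: rsum_ext => u; rewrite rprodM.
congr (_ * _ * Rmin 1 (_ * _)); apply: eq_bigr => i _; by rewrite !ffunE.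
Qed.

(** * Achievability *)

Lemma Rmin1_scale_le (x y : R) : 0 <= y -> x <= 2 * y -> Rmin 1 x <= 2 * Rmin 1 y.
Proof.
by move=> y0 xy; rewrite /Rmin; case: Rle_dec => h1; case: Rle_dec => h2; lra.
Qed.

Lemma rsum3_sub (A B C : finType) (f g h : A -> B -> C -> R) :
  rsum (fun a => rsum (fun b => rsum (fun c => f a b c - 2 * g a b c - h a b c)))
  = rsum (fun a => rsum (fun b => rsum (f a b))) -
    2 * rsum (fun a => rsum (fun b => rsum (g a b))) -
    rsum (fun a => rsum (fun b => rsum (h a b))).
Proof.
rewrite rsumZl -!rsumB; apply: rsum_ext => a.
rewrite rsumZl -!rsumB; apply: rsum_ext => b.
by rewrite rsumZl -!rsumB.
Qed.

(** The hypothesis on [R0] reads I(V;X) - I(V;Y) < R0 ln 2, in nats; [cond_MI_ratio] identifies the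
    left side with I(V;X|Y). *)
Lemma side_information_coding (X Y V : finType) (p : X -> Y -> R) (w : V -> X -> R) (R0 : R) :
  is_pmf p -> (forall v x, 0 <= w v x) -> (forall x, rsum (fun v => w v x) = 1) ->
  0 <= R0 ->
  rsum (fun x => rsum (fun y => rsum (fun v => p x y * w v x * ln (ratioX p w v x)))) -
  rsum (fun x => rsum (fun y => rsum (fun v => p x y * w v x * ln (ratioY p w v y))))
    < R0 * ln 2 ->
  forall eps, 0 < eps -> exists N : nat, forall n : nat, (N <= n)%nat ->
    exists (enc : {ffun 'I_n -> X} -> 'I_(msgs n R0))
           (dec : 'I_(msgs n R0) -> {ffun 'I_n -> Y} -> {ffun 'I_n -> V}),
      rsum (fun xs => rsum (fun ys =>
        indic (~~ posb (chn w (dec (enc xs) ys) xs)) * Pn p xs ys)) <= eps.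
Proof.
move=> pmf w0 w1 R00; have [p0 p1] := pmf.
set Ir := rsum _; set Is := rsum _ => hR eps e0.
(* A third of the gap: K is about exp (n (Is - d)), a margin d below the threshold of the second
   test, and M K is then about exp (n (Ir + 2 d)), a margin 2 d above that of the first. *)
pose d := (R0 * ln 2 - (Ir - Is)) / 3.
have d0 : 0 < d by rewrite /d; lra.
have rX0 x y v : 0 < p x y * w v x -> 0 < ratioX p w v x.
  move=> h; apply: Rdiv_lt_0_compat; last exact: out_law_gt0 h.
  by have := w0 v x; have := p0 x y; nra.
have rY0 x y v : 0 < p x y * w v x -> 0 < ratioY p w v y.
  move=> h; apply: Rdiv_lt_0_compat; first exact: outY_gt0 h.
  apply: Rmult_lt_0_compat; first exact: out_law_gt0 h.
  by apply: (pY_gt0 (a := x)) => //; have := w0 v x; have := p0 x y; nra.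
have [rho1 [r1 h1]] : exists rho, 0 <= rho < 1 /\ forall n,
    rsum (fun xs => rsum (fun ys => rsum (fun vs => @Pn X Y p n xs ys * chn w vs xs *
      Rmin 1 (exp (- (INR n * (Ir + 2 * d))) *
        rprod (fun i => ratioX p w (vs i) (xs i)))))) <= rho ^ n.
  apply: (source_channel_tail (r := fun x y v => ratioX p w v x)) => //.
  by rewrite -/Ir; lra.
have [rho2 [r2 h2]] : exists rho, 0 <= rho < 1 /\ forall n,
    rsum (fun xs => rsum (fun ys => rsum (fun vs => @Pn X Y p n xs ys * chn w vs xs *
      Rmin 1 (exp (- (INR n * (- Is + d))) *
        rprod (fun i => / ratioY p w (vs i) (ys i)))))) <= rho ^ n.
  apply: (source_channel_tail (r := fun x y v => / ratioY p w v y)) => //.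
    by move=> x y v h; apply/Rinv_0_lt_compat/(rY0 _ _ _ h).
  suff -> : rsum (fun x => rsum (fun y => rsum (fun v =>
      p x y * w v x * ln (/ ratioY p w v y)))) = - Is by lra.
  have -> : - Is = -1 * Is by ring.
  rewrite /Is rsumZl; apply: rsum_ext => x; rewrite rsumZl; apply: rsum_ext => y.
  rewrite rsumZl; apply: rsum_ext => v.
  case: (Rle_lt_or_eq_dec 0 (p x y * w v x)); first exact: Rmult_le_pos.
    by move=> h; rewrite ln_Rinv; [ring|exact: rY0 h].
  by move=> <-; ring.
have [|N1 hN1] := pow_eventually_lt (eps := eps / 4) r1; first lra.
have [|N2 hN2] := pow_eventually_lt (eps := eps / 4) r2; first lra.
exists (maxn N1 N2) => n; rewrite geq_max => /andP [/hN1 e1 /hN2 e2].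
have c0 vs xs : 0 <= @chn X V w n vs xs by apply: rprod_ge0.
(* As a floor, k is at most exp (n (Is - d)) and k + 1 exceeds it: the second test sees k, the size
   of the codebook k + 1. This holds for either sign of Is - d; if k = 0, every row has one word. *)
pose k := msgs n ((Is - d) / ln 2).
have [enc [dec hc]] := one_shot_side_information k (Pn_pmf n pmf) c0
  (fun xs => chn_sum1 xs w1) (msgs_gt0 n R00).
exists enc, dec.
have ln2 : 0 < ln 2 by rewrite -ln_1; apply: ln_increasing; lra.
have [k1 k2] := msgs_bounds n ((Is - d) / ln 2).
have kE : Rpower 2 (INR n * ((Is - d) / ln 2)) = exp (INR n * (Is - d)).
  by rewrite /Rpower; congr exp; field; lra.
rewrite -/k kE in k1 k2.
have M2 := msgs_ge_half n R00.
have MK : exp (INR n * (Ir + 2 * d)) / 2 <= INR (msgs n R0) * INR k.+1.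
  have -> : INR n * (Ir + 2 * d) = INR n * (R0 * ln 2) + INR n * (Is - d).
    by rewrite /d; field.
  rewrite exp_plus S_INR.
  have := exp_pos (INR n * (R0 * ln 2)); have := exp_pos (INR n * (Is - d)); nra.
have MK0 : 0 < INR (msgs n R0) * INR k.+1.
  by have := exp_pos (INR n * (Ir + 2 * d)); lra.
have tot : rsum (fun xs => rsum (fun ys => rsum (fun vs =>
    @Pn X Y p n xs ys * chn w vs xs))) = 1.
  rewrite -(proj2 (Pn_pmf n pmf)); apply: rsum_ext => xs; apply: rsum_ext => ys.
  by rewrite -rsumZl chn_sum1 // Rmult_1_r.
have good : 1 - 2 * rho1 ^ n - rho2 ^ n <= rsum (fun xs => rsum (fun ys =>
    indic (posb (chn w (dec (enc xs) ys) xs)) * Pn p xs ys)).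
  apply: Rle_trans hc.
  have comb (x y z : R) : x <= rho1 ^ n -> y <= rho2 ^ n ->
    1 - 2 * x - y <= z -> 1 - 2 * rho1 ^ n - rho2 ^ n <= z by lra.
  apply: (comb _ _ _ (h1 n) (h2 n)); rewrite -{1}tot -rsum3_sub.
  apply: rsum_le => xs; apply: rsum_le => ys; apply: rsum_le => vs.
  have P0 : 0 <= Pn p xs ys * chn w vs xs by apply: Rmult_le_pos; [exact: Pn_ge0|].
  case: P0 => [P0|<-]; last lra.
  have Pp : 0 < Pn p xs ys by have := Pn_ge0 xs ys p0; have := c0 vs xs; nra.
  have cp : 0 < chn w vs xs by have := Pn_ge0 xs ys p0; have := c0 vs xs; nra.
  have pi i : 0 < p (xs i) (ys i) * w (vs i) (xs i).
    apply: Rmult_lt_0_compat; first exact: Pn_gt0_inv Pp i.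
    by apply: (@rprod_gt0_inv _ (fun i => w (vs i) (xs i))).
  rewrite ratioX_Pn ratioY_Pn.
  set x := rprod (fun i => ratioX _ _ _ _); set y := rprod (fun i => ratioY _ _ _ _).
  have x0 : 0 < x by apply: rprod_gt0 => i; exact: rX0 (pi i).
  have y0 : 0 < y by apply: rprod_gt0 => i; exact: rY0 (pi i).
  have -> : rprod (fun i => / ratioY p w (vs i) (ys i)) = / y.
    have -> : / y = rprod (fun _ : 'I_n => 1) / y.
      by rewrite rprod_const pow1 /Rdiv Rmult_1_l.
    by rewrite -rprod_div; apply: rprod_ext => i; rewrite /Rdiv Rmult_1_l.
  have b1 : Rmin 1 (x / (INR (msgs n R0) * INR k.+1)) <=
      2 * Rmin 1 (exp (- (INR n * (Ir + 2 * d))) * x).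
    apply: Rmin1_scale_le.
      by apply: Rmult_le_pos; [exact: Rlt_le (exp_pos _)|lra].
    rewrite exp_Ropp.
    have E0 := exp_pos (INR n * (Ir + 2 * d)).
    have -> : 2 * (/ exp (INR n * (Ir + 2 * d)) * x) = x * / (exp (INR n * (Ir + 2 * d)) / 2).
      by field; lra.
    by apply: Rmult_le_compat_l; [lra|apply: Rinv_le_contravar; lra].
  have b2 : Rmin 1 (INR k / y) <= Rmin 1 (exp (- (INR n * (- Is + d))) * / y).
    have -> : - (INR n * (- Is + d)) = INR n * (Is - d) by ring.
    apply: Rle_min_compat_l; apply: Rmult_le_compat_r k2.
    by apply/Rlt_le/Rinv_0_lt_compat.
  nra.
have : rsum (fun xs => rsum (fun ys =>
        indic (~~ posb (chn w (dec (enc xs) ys) xs)) * Pn p xs ys)) =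
  1 - rsum (fun xs => rsum (fun ys =>
        indic (posb (chn w (dec (enc xs) ys) xs)) * Pn p xs ys)).
  rewrite -(proj2 (Pn_pmf n pmf)) -rsumB; apply: rsum_ext => xs.
  by rewrite -rsumB; apply: rsum_ext => ys; case: posb => /=; ring.
lra.
Qed.

Lemma source_tail (X Y : finType) (p : X -> Y -> R) (r : X -> Y -> R) (a : R) :
  is_pmf p -> (forall x y, 0 < p x y -> 0 < r x y) ->
  rsum (fun x => rsum (fun y => p x y * ln (r x y))) < a ->
  exists rho, 0 <= rho < 1 /\ forall n,
    rsum (fun xs => rsum (fun ys => @Pn X Y p n xs ys *
      Rmin 1 (exp (- (INR n * a)) * rprod (fun i => r (xs i) (ys i))))) <= rho ^ n.
Proof.
move=> [p0 p1] r0 ha.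
have [||||rho [rho1 h]] := @product_tail (X * Y)%type
  (fun z => p z.1 z.2) (fun z => r z.1 z.2) a.
- by [].
- by rewrite rsum_prod.
- by move=> z; exact: r0.
- by rewrite rsum_prod.
exists rho; split=> // n; apply: Rle_trans (h n); apply: Req_le.
rewrite rsum_ffun_pair; apply: rsum_ext => u.
congr (_ * Rmin 1 (_ * _)); apply: eq_bigr => i _; by rewrite !ffunE.
Qed.

Lemma ln2_gt0 : 0 < ln 2.
Proof. by rewrite -ln_1; apply: ln_increasing; lra. Qed.

(** * The law of f(X,Y) and its compression *)

Lemma pf_ge0 (X Y F : finType) (p : X -> Y -> R) (f : X -> Y -> F) (z : F) :
  (forall x y, 0 <= p x y) -> 0 <= pf p f z.
Proof.
move=> p0; apply: rsum_ge0 => x; apply: rsum_ge0 => y.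
by case: ifP => _; [|lra].
Qed.

Lemma pf_gt0 (X Y F : finType) (p : X -> Y -> R) (f : X -> Y -> F) (x : X) (y : Y) :
  (forall x y, 0 <= p x y) -> 0 < p x y -> 0 < pf p f (f x y).
Proof.
move=> p0 h; apply: Rlt_le_trans h _.
have t0 x' y' : 0 <= (if f x' y' == f x y then p x' y' else 0).
  by case: ifP => _; [|lra].
apply: Rle_trans (rsum_ge1 x (fun x' => rsum_ge0 (t0 x'))).
apply: Rle_trans (rsum_ge1 y (t0 x)).
by rewrite eqxx; lra.
Qed.

Lemma sum_pf_mul (X Y F : finType) (p : X -> Y -> R) (f : X -> Y -> F) (g : F -> R) :
  rsum (fun z => pf p f z * g z) = rsum (fun x => rsum (fun y => p x y * g (f x y))).
Proof.
rewrite (rsum_ext (h := fun z => rsum (fun x => rsum (fun y =>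
  indic (z == f x y) * (p x y * g z))))); last first.
  move=> z; rewrite rsumZr; apply: rsum_ext => x; rewrite rsumZr; apply: rsum_ext => y.
  by rewrite eq_sym; case: ifP => _ /=; ring.
rewrite rsum_exch; apply: rsum_ext => x; rewrite rsum_exch; apply: rsum_ext => y.
exact: (rsum_eq1 (fun z => p x y * g z)).
Qed.

Lemma sum_pf (X Y F : finType) (p : X -> Y -> R) (f : X -> Y -> F) :
  is_pmf p -> rsum (pf p f) = 1.
Proof.
move=> [p0 p1].
rewrite -(rsum_ext (g := fun z => pf p f z * 1)); last by move=> z; ring.
rewrite sum_pf_mul -[RHS]p1; apply: rsum_ext => x; apply: rsum_ext => y; ring.
Qed.

Lemma sum_ln_pf (X Y F : finType) (p : X -> Y -> R) (f : X -> Y -> F) :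
  (forall x y, 0 <= p x y) ->
  rsum (fun x => rsum (fun y => p x y * ln (pf p f (f x y)))) = - (entropy_f p f * ln 2).
Proof.
move=> p0; rewrite -(sum_pf_mul p f (fun z => ln (pf p f z))) /entropy_f.
rewrite Ropp_mult_distr_l Ropp_involutive rsumZr; apply: rsum_ext => z.
rewrite /plogp /Defs.log2; have l2 := ln2_gt0.
case: Rlt_dec => h /=; first by field; lra.
have -> : pf p f z = 0 by have := pf_ge0 f z p0; lra.
ring.
Qed.

Lemma entropy_f_ge0 (X Y F : finType) (p : X -> Y -> R) (f : X -> Y -> F) :
  is_pmf p -> 0 <= entropy_f p f.
Proof.
move=> pmf; have [p0 _] := pmf.
suff : 0 <= rsum (fun z => - plogp (pf p f z)).
  rewrite (rsum_ext (h := fun z => -1 * plogp (pf p f z))); last by move=> z; ring.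
  by rewrite -rsumZl /entropy_f; lra.
apply: rsum_ge0 => z; rewrite /plogp; case: Rlt_dec => h /=; last lra.
have h1 : pf p f z <= 1.
  by rewrite -(sum_pf f pmf); apply: rsum_ge1 => z'; exact: pf_ge0.
have l : ln (pf p f z) <= 0 by have := ln_le_sub1 h; lra.
have : Defs.log2 (pf p f z) <= 0.
  rewrite /Defs.log2 /Rdiv; have : 0 < / ln 2 by exact/Rinv_0_lt_compat/ln2_gt0.
  nra.
nra.
Qed.

Lemma index_code (T : finType) (t0 : T) (S : {set T}) (M : nat) :
  (0 < M)%nat -> (#|S| <= M)%nat ->
  exists (e : T -> 'I_M) (d : 'I_M -> T), forall t, t \in S -> d (e t) = t.
Proof.
case: M => // M _ SM.
exists (fun t => inord (index t (enum S))), (fun i => nth t0 (enum S) i) => t tS.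
have tE : t \in enum S by rewrite mem_enum.
rewrite inordK ?nth_index //; apply: leq_trans SM.
by rewrite cardE index_mem.
Qed.

Lemma function_compression (X Y F : finType) (p : X -> Y -> R) (f : X -> Y -> F) (RY : R) :
  is_pmf p -> entropy_f p f < RY ->
  forall eps, 0 < eps -> exists N : nat, forall n : nat, (N <= n)%nat ->
    exists (e : {ffun 'I_n -> F} -> 'I_(msgs n RY)) (d : 'I_(msgs n RY) -> {ffun 'I_n -> F}),
      rsum (fun xs => rsum (fun ys =>
        indic (d (e (fseq f xs ys)) != fseq f xs ys) * Pn p xs ys)) <= eps.
Proof.
move=> pmf HR eps e0; have [p0 p1] := pmf.
have RY0 : 0 <= RY by have := entropy_f_ge0 f pmf; lra.
have [||rho [r1 hr]] := @source_tail X Y p (fun x y => / pf p f (f x y)) (RY * ln 2) pmf.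
- by move=> x y h; apply/Rinv_0_lt_compat/pf_gt0.
- apply: Rle_lt_trans (_ : entropy_f p f * ln 2 < _); last first.
    by apply: Rmult_lt_compat_r HR; exact: ln2_gt0.
  have := sum_ln_pf f p0; set s := rsum _ => hs.
  have -> : entropy_f p f * ln 2 = -1 * s by lra.
  apply: Req_le; rewrite /s rsumZl; apply: rsum_ext => x; rewrite rsumZl.
  apply: rsum_ext => y; case: (p0 x y) => [h|<-]; last by ring.
  by rewrite ln_Rinv; [ring|exact: pf_gt0].
have [|N hN] := pow_eventually_lt (eps := eps / 2) r1; first lra.
exists N => n /hN e1.
pose M := msgs n RY.
(* The words of probability at least 1/M; the total mass 1 allows at most M of them, so they can be
   indexed exactly. *)
pose S := [set z : {ffun 'I_n -> F} | ~~ posb (1 - INR M * rprod (fun i => pf p f (z i)))].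
have SM : (#|S| <= M)%nat.
  apply/leP/INR_le; rewrite -rsum_indic_card.
  apply: Rle_trans (_ : rsum (fun z : {ffun 'I_n -> F} =>
      INR M * rprod (fun i => pf p f (z i))) <= _).
    apply: rsum_le => z; rewrite inE; case: posbP => /= h; last lra.
    by apply: Rmult_le_pos; [exact: pos_INR|apply: rprod_ge0 => i; exact: pf_ge0].
  rewrite -rsumZl (rsum_rprod (fun (i : 'I_n) z => pf p f z)) sum_pf // rprod_const pow1.
  lra.
have [xs0 [ys0 _]] : exists xs ys, 0 < @Pn X Y p n xs ys.
  have : 0 < rsum (fun xs => rsum (fun ys => @Pn X Y p n xs ys)).
    by rewrite (proj2 (Pn_pmf n pmf)); lra.
  by case/rsum_gt0_ex => xs /rsum_gt0_ex [ys h]; exists xs, ys.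
have [e [d hed]] := index_code (fseq f xs0 ys0) (msgs_gt0 n RY0) SM.
exists e, d.
apply: Rle_trans (_ : 2 * rho ^ n <= _); last lra.
apply: Rle_trans (Rmult_le_compat_l _ _ _ _ (hr n)); last lra.
rewrite rsumZl; apply: rsum_le => xs; rewrite rsumZl; apply: rsum_le => ys.
have m0 : 0 <= Rmin 1 (exp (- (INR n * (RY * ln 2))) *
    rprod (fun i => / pf p f (f (xs i) (ys i)))).
  apply: Rmin_glb; first lra.
  apply: Rmult_le_pos; first exact: Rlt_le (exp_pos _).
  apply: rprod_ge0 => i; have [h|<-] := pf_ge0 f (f (xs i) (ys i)) p0.
    exact/Rlt_le/Rinv_0_lt_compat.
  by rewrite Rinv_0; lra.
case: (Pn_ge0 xs ys p0) => [P0|<-]; last by rewrite Rmult_0_r; lra.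
case: (boolP (fseq f xs ys \in S)) => [/hed ->|].
  rewrite eqxx Rmult_0_l; apply: Rmult_le_pos; first lra.
  exact: Rmult_le_pos (Rlt_le _ _ P0) m0.
rewrite inE negbK => /posbP; set Q := rprod _ => hQ.
have Q0 : 0 < Q.
  by apply: rprod_gt0 => i; rewrite ffunE; apply: pf_gt0 => //; exact: Pn_gt0_inv P0 i.
have QE : rprod (fun i => / pf p f (f (xs i) (ys i))) = / Q.
  have -> : / Q = rprod (fun _ : 'I_n => 1) / Q.
    by rewrite rprod_const pow1 /Rdiv Rmult_1_l.
  by rewrite -rprod_div; apply: rprod_ext => i; rewrite /Rdiv Rmult_1_l ffunE.
rewrite QE in m0 *; clear QE.
(* Outside [S], M Q < 1, while M is at least half of exp (n RY ln 2); so the argument of the minimum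
   exceeds 1/2. *)
suff h : 1 <= 2 * Rmin 1 (exp (- (INR n * (RY * ln 2))) * / Q).
  have i1 := indic_le1 (d (e (fseq f xs ys)) != fseq f xs ys).
  rewrite [X in 2 * X]Rmult_comm -Rmult_assoc.
  apply: Rmult_le_compat_r; [lra|exact: Rle_trans i1 h].
rewrite -{1}(Rmin_left 1 1); last lra.
have M2 := msgs_ge_half n RY0; rewrite -/M in M2.
have E0 := exp_pos (INR n * (RY * ln 2)).
apply: Rmin1_scale_le.
  by apply: Rmult_le_pos; [exact: Rlt_le (exp_pos _)|apply/Rlt_le/Rinv_0_lt_compat].
rewrite exp_Ropp -Rinv_mult; set E := exp _ in M2 E0 *.
have EQ : 0 < E * Q by apply: Rmult_lt_0_compat.
apply: (Rmult_le_reg_r (E * Q)) => //; rewrite Rmult_assoc Rinv_l; last lra.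
nra.
Qed.

(** * Conditional graph entropy *)

(** Rules out the default value 0 of [Rinf], through the supremum of the negated set. *)
Lemma Rinf_glb (E : R -> Prop) (lb : R) :
  (exists x, E x) -> (forall x, E x -> lb <= x) -> is_glb E (Rinf E).
Proof.
move=> [x0 Ex0] hlb; rewrite /Rinf.
case: excluded_middle_informative => [H|]; first exact: proj2_sig.
case; have [||m [m1 m2]] := completeness (fun y => E (- y)).
- exists (- lb) => y /hlb; lra.
- by exists (- x0); rewrite Ropp_involutive.
exists (- m); split=> [x Ex|m' hm'].
  by have : - x <= m by [apply: m1; rewrite Ropp_involutive]; lra.
have : m <= - m' by apply: m2 => y /hm'; lra.
lra.
Qed.

Lemma cond_MI_sum (X Y : finType) (p : X -> Y -> R) (w : {set X} -> X -> R) :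
  (forall x y, 0 <= p x y) -> (forall v x, 0 <= w v x) ->
  cond_MI p w * ln 2 = rsum (fun x => rsum (fun y => rsum (fun v =>
    p x y * w v x * ln (p x y * w v x * pY p y / (pVY p w v y * p x y))))).
Proof.
move=> p0 w0; rewrite /cond_MI rsum_exch rsumZr; apply: rsum_ext => x.
rewrite rsum_exch rsumZr; apply: rsum_ext => y; rewrite rsumZr; apply: rsum_ext => v.
have l2 := ln2_gt0; have q0 := Rmult_le_pos _ _ (p0 x y) (w0 v x).
rewrite /Defs.log2; case: Rlt_dec => h /=; first by field; lra.
have -> : p x y * w v x = 0 by lra.
ring.
Qed.

(** The chain rule I(V;X|Y) = I(V;X) - I(V;Y) for a Markov chain V - X - Y; it holds letter by
    letter for the densities. *)
Lemma cond_MI_ratio (X Y : finType) (p : X -> Y -> R) (w : {set X} -> X -> R) :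
  (forall x y, 0 <= p x y) -> (forall v x, 0 <= w v x) ->
  cond_MI p w * ln 2 =
  rsum (fun x => rsum (fun y => rsum (fun v => p x y * w v x * ln (ratioX p w v x)))) -
  rsum (fun x => rsum (fun y => rsum (fun v => p x y * w v x * ln (ratioY p w v y)))).
Proof.
move=> p0 w0; rewrite cond_MI_sum // -rsumB; apply: rsum_ext => x.
rewrite -rsumB; apply: rsum_ext => y; rewrite -rsumB; apply: rsum_ext => v.
case: (Rmult_le_pos _ _ (p0 x y) (w0 v x)) => [h|<-]; last by ring.
have px : 0 < p x y by have := p0 x y; have := w0 v x; nra.
have wx : 0 < w v x by have := p0 x y; have := w0 v x; nra.
have o1 := outY_gt0 p0 w0 h; have o2 := out_law_gt0 p0 w0 h.
have o3 := pY_gt0 p0 px.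
have rX : 0 < ratioX p w v x by exact: Rdiv_lt_0_compat.
have rY : 0 < ratioY p w v y.
  by apply: Rdiv_lt_0_compat => //; apply: Rmult_lt_0_compat.
have -> : p x y * w v x * pY p y / (pVY p w v y * p x y) = ratioX p w v x * / ratioY p w v y.
  by rewrite /ratioX /ratioY -[pVY p w v y]/(outY p w v y); field; lra.
by rewrite ln_mult ?ln_Rinv //; [ring|exact: Rinv_0_lt_compat].
Qed.

(** By ln u >= 1 - 1/u, the sum is at least 1 minus the mass of P(v,y) P(x|y), which is at most
    1. *)
Lemma cond_MI_ge0 (X Y : finType) (p : X -> Y -> R) (w : {set X} -> X -> R) :
  is_pmf p -> (forall v x, 0 <= w v x) -> (forall x, rsum (fun v => w v x) = 1) ->
  0 <= cond_MI p w.
Proof.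
move=> [p0 p1] w0 w1; have l2 := ln2_gt0.
suff : 0 <= cond_MI p w * ln 2 by nra.
rewrite cond_MI_sum //.
apply: Rle_trans (_ : rsum (fun x => rsum (fun y => rsum (fun v =>
  p x y * w v x - outY p w v y * (p x y / pY p y)))) <= _).
  rewrite (rsum_ext (h := fun x => rsum (fun y => p x y) -
      rsum (fun y => p x y * (pY p y / pY p y)))).
    rewrite rsumB p1 -{1}p1 -rsumB; apply: rsum_ge0 => x; rewrite -rsumB.
    apply: rsum_ge0 => y; case: (pY_ge0 y p0) => [h|h].
      by apply: Req_le; field; lra.
    by have := p0 x y; rewrite -h /Rdiv; lra.
  move=> x; rewrite -rsumB; apply: rsum_ext => y.
  by rewrite rsumB -rsumZl w1 -rsumZr sum_outY // /Rdiv; ring.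
apply: rsum_le => x; apply: rsum_le => y; apply: rsum_le => v.
have o1 := outY_ge0 v y p0 w0.
case: (Rmult_le_pos _ _ (p0 x y) (w0 v x)) => [h|<-]; last first.
  have := Rmult_le_pos _ _ o1 (Rdiv_ge0 (p0 x y) (pY_ge0 y p0)); lra.
have px : 0 < p x y by have := p0 x y; have := w0 v x; nra.
have wx : 0 < w v x by have := p0 x y; have := w0 v x; nra.
have o2 := outY_gt0 p0 w0 h; have o3 := pY_gt0 p0 px.
rewrite -[pVY p w v y]/(outY p w v y).
set u := p x y * w v x * pY p y / (outY p w v y * p x y).
have u0 : 0 < u by apply: Rdiv_lt_0_compat; apply: Rmult_lt_0_compat.
have := ln_le_sub1 (Rinv_0_lt_compat _ u0); rewrite ln_Rinv // => hl.
have -> : outY p w v y * (p x y / pY p y) = p x y * w v x * / u.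
  by rewrite /u; field; lra.
nra.
Qed.

Lemma singleton_admissible (X Y F : finType) (p : X -> Y -> R) (f : X -> Y -> F) :
  admissible_V p f (fun v x => indic (v == [set x])).
Proof.
split; first by move=> v x; exact: indic_ge0.
split=> [x|v x].
  by rewrite -[RHS](rsum_eq1 (fun _ => 1) [set x]); apply: rsum_ext => v; rewrite Rmult_1_r.
case: eqVneq => [->|_] /=; last lra.
move=> _; split; last by rewrite inE.
by move=> x1 x2 /set1P -> /set1P -> [y []].
Qed.

Lemma cond_graph_entropy_glb (X Y F : finType) (p : X -> Y -> R) (f : X -> Y -> F) :
  is_pmf p ->
  is_glb (fun r => exists w, admissible_V p f w /\ r = cond_MI p w) (cond_graph_entropy p f).
Proof.
move=> pmf; apply: (@Rinf_glb _ 0).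
  by exists (cond_MI p (fun v x => indic (v == [set x]))), (fun v x => indic (v == [set x]));
    split=> //; exact: singleton_admissible.
by move=> r [w [[w0 [w1 _]] ->]]; exact: cond_MI_ge0.
Qed.

Lemma cond_graph_entropy_ge0 (X Y F : finType) (p : X -> Y -> R) (f : X -> Y -> F) :
  is_pmf p -> 0 <= cond_graph_entropy p f.
Proof.
move=> pmf; apply: (proj2 (cond_graph_entropy_glb f pmf)).
by move=> r [w [[w0 [w1 _]] ->]]; exact: cond_MI_ge0.
Qed.

(* All x in an independent set that are compatible with y give the same f x y. *)
Definition graph_decode (X Y F : finType) (p : X -> Y -> R) (f : X -> Y -> F) (z0 : F)
  (v : {set X}) (y : Y) : F :=
  if [pick x in v | posb (p x y)] is Some x then f x y else z0.

Lemma graph_decodeE (X Y F : finType) (p : X -> Y -> R) (f : X -> Y -> F) (z0 : F)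
    (v : {set X}) (x : X) (y : Y) :
  indep_set p f v -> x \in v -> 0 < p x y -> graph_decode p f z0 v y = f x y.
Proof.
move=> iv xv pxy; rewrite /graph_decode; case: pickP => [x'|/(_ x)]; last first.
  by rewrite /= xv; case: posbP.
case/andP=> x'v /posbP px'; case: (eqVneq (f x' y) (f x y)) => // /eqP ne.
case: (iv x' x x'v xv); exists y; split=> //; exact: Rmult_lt_0_compat.
Qed.

(** The strict inequality on [R0] lets a single channel be chosen below it, so the infimum need not
    be attained. *)
Lemma achievable_above (X Y F : finType) (p : X -> Y -> R) (f : X -> Y -> F) (R0 RY : R) :
  is_pmf p -> cond_graph_entropy p f < R0 -> entropy_f p f < RY ->
  achievable p f R0 0 RY.
Proof.
move=> pmf hG hf eps e0; have [p0 p1] := pmf.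
have [w [[w0 [w1 wadm]] hw]] : exists w, admissible_V p f w /\ cond_MI p w < R0.
  apply: NNPP => h; have [_ /(_ R0) hlb] := cond_graph_entropy_glb f pmf.
  have : R0 <= cond_graph_entropy p f; last by lra.
  apply: hlb => r [w [wa ->]]; apply: Rnot_lt_le => hw; apply: h; by exists w.
have R00 : 0 <= R0 by have := cond_graph_entropy_ge0 f pmf; lra.
have [||N1 hN1] := @side_information_coding X Y _ p w R0 pmf w0 w1 R00 _ (eps / 2).
- by rewrite -cond_MI_ratio //; apply: Rmult_lt_compat_r hw; exact: ln2_gt0.
- by lra.
have [|N2 hN2] := function_compression pmf hf (eps := eps / 2); first lra.
exists (maxn N1 N2) => n; rewrite geq_max => /andP [/hN1 [enc [dec h1]] /hN2 [e [d h2]]].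
have [x0 [y0 _]] : exists x y, 0 < p x y.
  have : 0 < rsum (fun x => rsum (fun y => p x y)) by rewrite p1; lra.
  by case/rsum_gt0_ex => x /rsum_gt0_ex [y h]; exists x, y.
pose gd := graph_decode p f (f x0 y0).
(* At rate 0 there is exactly one message. The second node already knows f at all places when the
   word is compatible, and it sends the compressed values. *)
exists enc, (fun _ => Ordinal (msgs_gt0 n (Rle_refl 0))),
  (fun ys m => e [ffun i => gd (dec m ys i) (ys i)]), (fun _ => d).
apply: Rle_trans (_ : eps / 2 + eps / 2 <= _); last lra.
apply: Rle_trans (Rplus_le_compat _ _ _ _ h1 h2).
rewrite -rsumD; apply: rsum_le => xs; rewrite -rsumD; apply: rsum_le => ys.
case: (Pn_ge0 xs ys p0) => [P0|<-]; last by case: ifP => _; lra.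
case: posbP => [c0|_] /=; last first.
  have := Rmult_le_pos _ _ (indic_ge0 (d (e (fseq f xs ys)) != fseq f xs ys)) (Rlt_le _ _ P0).
  by case: ifP => _; lra.
have -> : [ffun i => gd (dec (enc xs) ys i) (ys i)] = fseq f xs ys.
  apply/ffunP => i; rewrite !ffunE.
  have pi := Pn_gt0_inv p0 P0 i.
  have wi : 0 < w (dec (enc xs) ys i) (xs i).
    by apply: (@rprod_gt0_inv _ (fun i => w (dec (enc xs) ys i) (xs i))).
  have pX0 : 0 < pX p (xs i).
    apply: Rlt_le_trans pi _; exact: (@rsum_ge1 _ (fun y => p (xs i) y)).
  have [iv xv] := wadm _ _ (Rmult_lt_0_compat _ _ pX0 wi).
  exact: graph_decodeE.
by case: (_ != _) => /=; lra.
Qed.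

(** * Converse for the rate of [f] *)

Lemma fseq_law (X Y F : finType) (p : X -> Y -> R) (f : X -> Y -> F) (n : nat)
    (z : {ffun 'I_n -> F}) :
  rsum (fun xs => rsum (fun ys => indic (z == fseq f xs ys) * Pn p xs ys))
  = rprod (fun i => pf p f (z i)).
Proof.
rewrite -(rsum2_rprod (fun i x y => if f x y == z i then p x y else 0)).
apply: rsum_ext => xs; apply: rsum_ext => ys.
case: eqVneq => [->|ne] /=.
  by rewrite Rmult_1_l; apply: eq_bigr => i _; rewrite ffunE eqxx.
rewrite Rmult_0_l; have [i hi] : exists i, f (xs i) (ys i) != z i.
  apply/existsP; rewrite -negb_forall; apply: contra ne => /forallP h.
  by apply/eqP/ffunP => i; rewrite ffunE (eqP (h i)).
by rewrite (rprod_split1 _ i) (negbTE hi) Rmult_0_l.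
Qed.

(** The decoder sees only the two messages of rates b and c, so it has at most 2^(n (b + c))
    outputs. *)
Lemma function_rate_converse (X Y F : finType) (p : X -> Y -> R) (f : X -> Y -> F) (a b c : R) :
  is_pmf p -> achievable p f a b c -> entropy_f p f <= b + c.
Proof.
move=> pmf ach; have [p0 p1] := pmf; apply: Rnot_lt_le => hlt.
have l2 := ln2_gt0.
(* Halfway, in nats, between the rate and the entropy: words of probability at least e^(-n al) are
   rare, and the outputs below this level are too few to carry mass. *)
pose al := (b + c + entropy_f p f) / 2 * ln 2.
have [||rho [r1 hr]] := @source_tail X Y p (fun x y => pf p f (f x y)) (- al) pmf.
- by move=> x y h; exact: pf_gt0.
- rewrite sum_ln_pf // /al; nra.
pose sg := exp ((b + c) * ln 2 - al).
have s1 : 0 <= sg < 1.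
  split; first exact: Rlt_le (exp_pos _).
  by rewrite -exp_0; apply: exp_increasing; rewrite /al; nra.
have [|N1 h1] := pow_eventually_lt (eps := 1 / 4) r1; first lra.
have [|N2 h2] := pow_eventually_lt (eps := 1 / 4) s1; first lra.
have [|N3 h3] := ach (1 / 4); first lra.
pose n := maxn N1 (maxn N2 N3).
have {h1} e1 := h1 n (leq_maxl _ _).
have {h2} e2 : sg ^ n < 1 / 4 by apply: h2; rewrite /n leq_max leq_maxl orbT.
have {h3} [|phi0 [phiX [phiY [psi e3]]]] := h3 n.
  by rewrite /n leq_max [X in _ || X]leq_max leqnn !orbT.
have {hr} := hr n.
have -> : - (INR n * - al) = INR n * al by ring.
move=> hr.
pose D : finType := ('I_(msgs n b) * 'I_(msgs n c))%type.
pose t := exp (- (INR n * al)).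
have t0 : 0 < t by exact: exp_pos.
have hD : rsum (fun d : D => rsum (fun xs => rsum (fun ys =>
    indic (posb (t - rprod (fun i => pf p f (psi d.1 d.2 i)))) *
    (indic (psi d.1 d.2 == fseq f xs ys) * Pn p xs ys)))) <= sg ^ n.
  apply: Rle_trans (_ : rsum (fun d : D => t) <= _).
    apply: rsum_le => d.
    rewrite (rsum_ext (h := fun xs =>
      indic (posb (t - rprod (fun i => pf p f (psi d.1 d.2 i)))) *
      rsum (fun ys => indic (psi d.1 d.2 == fseq f xs ys) * Pn p xs ys))); last first.
      by move=> xs; rewrite rsumZl.
    rewrite -rsumZl fseq_law; case: posbP => /= h; lra.
  rewrite rsum_const card_prod !card_ord mult_INR.
  have -> : sg ^ n = Rpower 2 (INR n * b) * Rpower 2 (INR n * c) * t.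
    rewrite -Rpower_pow; last exact: exp_pos.
    by rewrite /Rpower /sg ln_exp /t -!exp_plus; congr exp; ring.
  apply: Rmult_le_compat_r; first lra.
  by apply: Rmult_le_compat; try exact: pos_INR; exact: (proj2 (msgs_bounds _ _)).
(* Every pair (xs, ys) is decoded wrongly, or its value word has probability at least [t], or that
   word is an output of probability below [t]. Each event has mass at most 1/4, against a total of
   1. *)
have comb (x e s d : R) : x = 1 -> e <= 1 / 4 -> s <= rho ^ n -> d <= sg ^ n ->
  x <= e + s + d -> False by lra.
apply: (comb _ _ _ _ (proj2 (Pn_pmf n pmf)) e3 hr hD).
rewrite [X in _ <= _ + X]rsum_exch -!rsumD; apply: rsum_le => xs.
rewrite [X in _ <= _ + X]rsum_exch -!rsumD; apply: rsum_le => ys.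
have P0 := Pn_ge0 xs ys p0.
set m := Rmin _ _; have m0 : 0 <= m.
  apply: Rmin_glb; first lra.
  apply: Rmult_le_pos; first exact: Rlt_le (exp_pos _).
  by apply: rprod_ge0 => i; exact: pf_ge0.
have Pm := Rmult_le_pos _ _ P0 m0.
set d0 : D := (phiX xs, phiY ys (phi0 xs)).
set S := rsum _; have S0 : forall d : D, 0 <= indic (posb (t - rprod (fun i => pf p f (psi d.1 d.2 i)))) *
    (indic (psi d.1 d.2 == fseq f xs ys) * Pn p xs ys).
  by move=> d; apply: Rmult_le_pos (indic_ge0 _) (Rmult_le_pos _ _ (indic_ge0 _) P0).
have Sd := rsum_ge1 d0 S0; have Sp := rsum_ge0 S0; rewrite -/S /= in Sd Sp.
case: eqVneq Sd => [-> /=|_ _ /=]; last lra.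
rewrite (rprod_ext (h := fun i => pf p f (f (xs i) (ys i)))); last first.
  by move=> i; rewrite ffunE.
set Q := rprod _; case: posbP => /= h; first lra.
have -> : m = 1; last lra.
apply: Rmin_left; apply: Rle_trans (_ : exp (INR n * al) * Q <= _); last exact: Rle_refl.
have tE : t * exp (INR n * al) = 1 by rewrite /t -exp_plus Rplus_opp_l exp_0.
have := exp_pos (INR n * al); nra.
Qed.

(** * Converse for the rate of the description of [X] *)

Definition upd (Y : finType) (n : nat) (ys : {ffun 'I_n -> Y}) (i : 'I_n) (y : Y) :
  {ffun 'I_n -> Y} := [ffun j => if j == i then y else ys j].

Lemma upd_same (Y : finType) (n : nat) (ys : {ffun 'I_n -> Y}) i y : upd ys i y i = y.
Proof. by rewrite ffunE eqxx. Qed.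

Lemma upd_upd (Y : finType) (n : nat) (ys : {ffun 'I_n -> Y}) i y y' :
  upd (upd ys i y) i y' = upd ys i y'.
Proof. by apply/ffunP => j; rewrite !ffunE; case: (j == i). Qed.

Lemma upd_id (Y : finType) (n : nat) (ys : {ffun 'I_n -> Y}) i : upd ys i (ys i) = ys.
Proof. by apply/ffunP => j; rewrite !ffunE; case: eqP => // ->. Qed.

Lemma Pn_upd_swap (X Y : finType) (p : X -> Y -> R) (n : nat) (xs : {ffun 'I_n -> X})
    (ys : {ffun 'I_n -> Y}) i y :
  Pn p xs (upd ys i y) * p (xs i) (ys i) = Pn p xs ys * p (xs i) y.
Proof.
rewrite /Pn (bigD1 i) //= [in RHS](bigD1 i) //= upd_same.
set Q := (X in _ = _ * X * _).
have -> : \big[Rmult/1]_(j < n | j != i) p (xs j) (upd ys i y j) = Q; last by ring.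
by apply: eq_bigr => j /negbTE ji; rewrite ffunE ji.
Qed.

(* Exchanging Y_i with a fresh copy is an involution that preserves the law. *)
Lemma resample (X Y : finType) (p : X -> Y -> R) (n : nat) (xs : {ffun 'I_n -> X}) (i : 'I_n)
    (phi : {ffun 'I_n -> Y} -> R) :
  rsum (fun ys => Pn p xs ys * rsum (fun y => p (xs i) y * phi (upd ys i y)))
  = pX p (xs i) * rsum (fun ys => Pn p xs ys * phi ys).
Proof.
pose sw (u : {ffun 'I_n -> Y} * Y) := (upd u.1 i u.2, u.1 i).
have swK : involutive sw.
  by case=> ys y; rewrite /sw /= upd_upd upd_same upd_id.
transitivity (rsum (fun u : {ffun 'I_n -> Y} * Y =>
    Pn p xs u.1 * (p (xs i) u.2 * phi (upd u.1 i u.2)))).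
  by rewrite rsum_prod; apply: rsum_ext => ys; rewrite rsumZl.
rewrite (rsum_reindex _ (inv_bij swK)) rsum_prod rsumZl; apply: rsum_ext => ys.
rewrite /pX rsumZr; apply: rsum_ext => y /=.
by rewrite upd_upd upd_id -Rmult_assoc Pn_upd_swap; ring.
Qed.

Lemma Pn_marginal (X Y : finType) (p : X -> Y -> R) (n : nat) (i : 'I_n) (phi : X -> Y -> R) :
  is_pmf p ->
  rsum (fun xs => rsum (fun ys => Pn p xs ys * phi (xs i) (ys i)))
  = rsum (fun x => rsum (fun y => p x y * phi x y)).
Proof.
move=> [p0 p1].
transitivity (rsum (fun xs : {ffun 'I_n -> X} => rsum (fun ys : {ffun 'I_n -> Y} =>
    rprod (fun j => p (xs j) (ys j) * (if j == i then phi (xs j) (ys j) else 1))))).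
  apply: rsum_ext => xs; apply: rsum_ext => ys; rewrite rprodM; congr (_ * _).
  by rewrite (rprod_split1 _ i) eqxx big1 ?Rmult_1_r // => j /negbTE ->.
rewrite (rsum2_rprod (fun j x y => p x y * (if j == i then phi x y else 1))).
rewrite (rprod_split1 _ i) eqxx big1 ?Rmult_1_r // => j /negbTE ->.
by rewrite -[RHS]p1; apply: rsum_ext => x; apply: rsum_ext => y; ring.
Qed.

Lemma rsum_exch32 (A B C D E : finType) (T : A -> B -> C -> D -> E -> R) :
  rsum (fun a => rsum (fun b => rsum (fun c => rsum (fun d => rsum (fun e => T a b c d e)))))
  = rsum (fun d => rsum (fun e => rsum (fun a => rsum (fun b => rsum (fun c => T a b c d e))))).
Proof.
transitivity (rsum (fun z : A * B * C => rsum (fun u : D * E => T z.1.1 z.1.2 z.2 u.1 u.2))).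
  rewrite [RHS]rsum_prod [RHS]rsum_prod; apply: rsum_ext => a; apply: rsum_ext => b.
  by apply: rsum_ext => c; rewrite rsum_prod.
rewrite [LHS]rsum_exch [LHS]rsum_prod;  apply: rsum_ext => d; apply: rsum_ext => e.
by rewrite [LHS]rsum_prod [LHS]rsum_prod.
Qed.

(** * The channel from X_i to V_i *)

Lemma pX_gt0 (X Y : finType) (p : X -> Y -> R) (x : X) (y : Y) :
  (forall x y, 0 <= p x y) -> 0 < p x y -> 0 < pX p x.
Proof.
by move=> p0 h; apply: Rlt_le_trans h _; apply: (@rsum_ge1 _ (fun y => p x y)).
Qed.

(* The conditional law of V(X^n, Y^n) given X_i = x; the point mass at {x} when
   X_i = x has probability 0, so that admissibility holds for every x. *)
Definition chan_of (X Y : finType) (p : X -> Y -> R) (n : nat) (i : 'I_n)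
  (V : {ffun 'I_n -> X} -> {ffun 'I_n -> Y} -> {set X}) (v : {set X}) (x : X) : R :=
  if posb (pX p x) then
    rsum (fun xs : {ffun 'I_n -> X} => rsum (fun ys : {ffun 'I_n -> Y} =>
      indic (x == xs i) * (indic (v == V xs ys) * Pn p xs ys))) / pX p x
  else indic (v == [set x]).

Lemma chan_of_ge0 (X Y : finType) (p : X -> Y -> R) (n : nat) (i : 'I_n) V v x :
  (forall x y, 0 <= p x y) -> 0 <= @chan_of X Y p n i V v x.
Proof.
move=> p0; rewrite /chan_of; case: posbP => h; last exact: indic_ge0.
apply: Rdiv_ge0; last lra.
apply: rsum_ge0 => xs; apply: rsum_ge0 => ys.
by apply: Rmult_le_pos (indic_ge0 _) (Rmult_le_pos _ _ (indic_ge0 _) (Pn_ge0 _ _ p0)).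
Qed.

Lemma chan_of_sum1 (X Y : finType) (p : X -> Y -> R) (n : nat) (i : 'I_n) V x :
  is_pmf p -> rsum (fun v => @chan_of X Y p n i V v x) = 1.
Proof.
move=> pmf; rewrite /chan_of; case: posbP => h; last first.
  by rewrite -[RHS](rsum_eq1 (fun _ => 1) [set x]); apply: rsum_ext => v; rewrite Rmult_1_r.
rewrite /Rdiv -rsumZr.
suff -> : rsum (fun v => rsum (fun xs : {ffun 'I_n -> X} => rsum (fun ys : {ffun 'I_n -> Y} =>
    indic (x == xs i) * (indic (v == V xs ys) * Pn p xs ys)))) = pX p x.
  by rewrite Rinv_r; lra.
transitivity (rsum (fun xs : {ffun 'I_n -> X} => rsum (fun ys : {ffun 'I_n -> Y} =>
    Pn p xs ys * (fun x' _ => indic (x == x')) (xs i) (ys i)))).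
  rewrite rsum_exch; apply: rsum_ext => xs; rewrite rsum_exch; apply: rsum_ext => ys.
  by rewrite -rsumZl (rsum_eq1 (fun _ => Pn p xs ys)) Rmult_comm.
rewrite (Pn_marginal i (fun x' _ => indic (x == x')) pmf).
rewrite -[RHS](rsum_eq1 (fun x' => pX p x')); apply: rsum_ext => x'.
by rewrite /pX rsumZl; apply: rsum_ext => y; rewrite eq_sym Rmult_comm.
Qed.

Lemma chan_of_gt0 (X Y : finType) (p : X -> Y -> R) (n : nat) (i : 'I_n) V xs ys :
  (forall x y, 0 <= p x y) -> 0 < Pn p xs ys -> 0 < @chan_of X Y p n i V (V xs ys) (xs i).
Proof.
move=> p0 h; have hp := pX_gt0 p0 (Pn_gt0_inv p0 h i).
rewrite /chan_of; case: posbP => // _; apply: Rdiv_lt_0_compat => //.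
have t0 (xs' : {ffun 'I_n -> X}) (ys' : {ffun 'I_n -> Y}) : 0 <= indic (xs i == xs' i) * (indic (V xs ys == V xs' ys') * Pn p xs' ys').
  by apply: Rmult_le_pos (indic_ge0 _) (Rmult_le_pos _ _ (indic_ge0 _) (Pn_ge0 _ _ p0)).
apply: Rlt_le_trans h _.
apply: Rle_trans (rsum_ge1 xs (fun xs' => rsum_ge0 (t0 xs'))).
apply: Rle_trans (rsum_ge1 ys (t0 xs)).
by rewrite !eqxx /=; lra.
Qed.

Lemma chan_of_support (X Y : finType) (p : X -> Y -> R) (n : nat) (i : 'I_n) V v x :
  (forall x y, 0 <= p x y) -> 0 < pX p x * @chan_of X Y p n i V v x ->
  exists (xs : {ffun 'I_n -> X}) (ys : {ffun 'I_n -> Y}), x = xs i /\ v = V xs ys.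
Proof.
move=> p0 h; have c0 := @chan_of_ge0 X Y p n i V v x p0.
have px : 0 < pX p x.
  by have : 0 <= pX p x by [apply: rsum_ge0]; nra.
have {h} : 0 < chan_of p i V v x by nra.
rewrite /chan_of; case: posbP => // _ h.
have {h} : 0 < rsum (fun xs : {ffun 'I_n -> X} => rsum (fun ys : {ffun 'I_n -> Y} =>
      indic (x == xs i) * (indic (v == V xs ys) * Pn p xs ys))).
  have := Rmult_lt_0_compat _ _ h px; rewrite /Rdiv Rmult_assoc Rinv_l; lra.
case/rsum_gt0_ex => xs /rsum_gt0_ex [ys H]; exists xs, ys; move: H.
by case: eqVneq => [->|_] /=; [|lra]; case: eqVneq => [->|_] /=; [|lra].
Qed.

(** The Markov property: a V that ignores Y_i may be evaluated before Y_i is redrawn given X_i, so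
    passing X_i through the channel reproduces the true law of (V_i, X_i, Y_i). *)
Lemma chan_of_joint (X Y : finType) (p : X -> Y -> R) (n : nat) (i : 'I_n) V
    (psi : {set X} -> X -> Y -> R) :
  (forall x y, 0 <= p x y) -> (forall xs ys y, V xs (upd ys i y) = V xs ys) ->
  rsum (fun x => rsum (fun y => rsum (fun v => p x y * @chan_of X Y p n i V v x * psi v x y)))
  = rsum (fun xs : {ffun 'I_n -> X} => rsum (fun ys : {ffun 'I_n -> Y} => Pn p xs ys * psi (V xs ys) (xs i) (ys i))).
Proof.
move=> p0 hV.
transitivity (rsum (fun xs : {ffun 'I_n -> X} => rsum (fun ys : {ffun 'I_n -> Y} => Pn p xs ys *
    (/ pX p (xs i) * rsum (fun y => p (xs i) y * psi (V xs ys) (xs i) y))))).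
  transitivity (rsum (fun x => rsum (fun y => rsum (fun v => rsum (fun xs : {ffun 'I_n -> X} => rsum (fun ys : {ffun 'I_n -> Y} =>
      indic (x == xs i) * (indic (v == V xs ys) *
      (Pn p xs ys * (/ pX p x * (p x y * psi v x y)))))))))).
    apply: rsum_ext => x; apply: rsum_ext => y; apply: rsum_ext => v.
    case: (p0 x y) => [h|<-]; last first.
      rewrite !Rmult_0_l; symmetry; apply: rsum0 => xs; apply: rsum0 => ys; ring.
    rewrite /chan_of; case: posbP => [_|]; last by have := pX_gt0 p0 h.
    rewrite /Rdiv rsumZr rsumZl rsumZr; apply: rsum_ext => xs.
    rewrite rsumZr rsumZl rsumZr; apply: rsum_ext => ys.
    have re (a b c d e g : R) : a * (b * (c * d) * e) * g = b * (c * (d * (e * (a * g)))).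
      by ring.
    exact: re.
  rewrite rsum_exch32; apply: rsum_ext => xs; apply: rsum_ext => ys.
  rewrite -[RHS](rsum_eq1 (fun x => Pn p xs ys * (/ pX p x *
    rsum (fun y => p x y * psi (V xs ys) x y))) (xs i)).
  apply: rsum_ext => x; rewrite !rsumZl; apply: rsum_ext => y.
  by rewrite -rsumZl (rsum_eq1 (fun v => Pn p xs ys * (/ pX p x * (p x y * psi v x y)))).
apply: rsum_ext => xs.
have [h|h] : 0 <= pX p (xs i) by apply: rsum_ge0.
  have := resample p xs i (fun ys => psi (V xs ys) (xs i) (ys i)) => hr.
  apply: (Rmult_eq_reg_l (pX p (xs i))); last lra.
  rewrite -hr rsumZl; apply: rsum_ext => ys.
  have re (a b c : R) : a <> 0 -> a * (b * (/ a * c)) = b * c by move=> a0; field.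
  rewrite re; last lra.
  by congr (_ * _); apply: rsum_ext => y; rewrite hV upd_same.
apply: rsum_ext => ys; case: (Pn_ge0 xs ys p0) => [P0|<-]; last by ring.
by have := pX_gt0 p0 (Pn_gt0_inv p0 P0 i); rewrite -h => /Rlt_irrefl.
Qed.

(** * Single-letter bound by the number of messages *)

Lemma rprod_le (T : finType) (g h : T -> R) :
  (forall t, 0 <= g t <= h t) -> rprod g <= rprod h.
Proof.
move=> gh; suff : 0 <= rprod g <= rprod h by lra.
apply: (big_ind2 (fun x y => 0 <= x <= y)) => [|a b c d h1 h2|t _]; [lra| |exact: gh].
split; first by apply: Rmult_le_pos; lra.
by apply: Rmult_le_compat; lra.
Qed.

Lemma pY_sum1 (X Y : finType) (p : X -> Y -> R) : is_pmf p -> rsum (pY p) = 1.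
Proof. by move=> [_ p1]; rewrite -[RHS]p1 rsum_exch. Qed.

(* Gibbs' inequality against the conditional law of (X^n, V^n) that codes V_i by
   Q i (the law of V_i guessed from the message) and X_i given (V_i, Y_i) by its
   true law, mixed over the messages. *)
Lemma message_bound (X Y Msg : finType) (p : X -> Y -> R) (n : nat)
    (m : {ffun 'I_n -> X} -> Msg)
    (V : 'I_n -> {ffun 'I_n -> X} -> {ffun 'I_n -> Y} -> {set X})
    (Q : 'I_n -> Msg -> {ffun 'I_n -> Y} -> {set X} -> R) :
  is_pmf p -> (forall i xs ys y, V i xs (upd ys i y) = V i xs ys) ->
  (forall i mm ys v, 0 < Q i mm ys v) -> (forall i mm ys, rsum (Q i mm ys) <= 1) ->
  rsum (fun i => cond_MI p (chan_of p i (V i)) * ln 2) +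
  rsum (fun i => rsum (fun xs : {ffun 'I_n -> X} => rsum (fun ys : {ffun 'I_n -> Y} =>
    Pn p xs ys * ln (Q i (m xs) ys (V i xs ys))))) <= ln (INR #|Msg|).
Proof.
move=> pmf hV Q0 Q1; have [p0 p1] := pmf.
pose w i := chan_of p i (V i).
have w0 i v x : 0 <= w i v x by exact: chan_of_ge0.
(* [r] is P(x | v, y) at place i, and [u] is the ratio P(x | v, y) / P(x | y) whose mean logarithm
   is I(V_i;X_i|Y_i). *)
pose r i v x y := p x y * w i v x / outY p (w i) v y.
pose u i v x y := p x y * w i v x * pY p y / (outY p (w i) v y * p x y).
have r0 i v x y : 0 <= r i v x y.
  by apply: Rdiv_ge0; [apply: Rmult_le_pos|exact: outY_ge0].
have [xs0 [ys0 P00]] : exists xs ys, 0 < @Pn X Y p n xs ys.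
  have : 0 < rsum (fun xs : {ffun 'I_n -> X} => rsum (fun ys : {ffun 'I_n -> Y} => @Pn X Y p n xs ys)).
    by rewrite (proj2 (Pn_pmf n pmf)); lra.
  by case/rsum_gt0_ex => xs /rsum_gt0_ex [ys h]; exists xs, ys.
pose c := INR #|Msg|.
have c0 : 0 < c.
  by apply: lt_0_INR; apply/ltP; apply/card_gt0P; exists (m xs0).
pose U xs ys := rprod (fun i => u i (V i xs ys) (xs i) (ys i) * Q i (m xs) ys (V i xs ys)).
have wp i xs ys : 0 < Pn p xs ys -> 0 < p (xs i) (ys i) * w i (V i xs ys) (xs i).
  move=> h; apply: Rmult_lt_0_compat; first exact: Pn_gt0_inv h i.
  exact: chan_of_gt0.
have up xs ys i : 0 < Pn p xs ys -> 0 < u i (V i xs ys) (xs i) (ys i).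
  move=> h; have pi := Pn_gt0_inv p0 h i; have hw := wp i xs ys h.
  apply: Rdiv_lt_0_compat; apply: Rmult_lt_0_compat => //.
    exact: pY_gt0 pi.
  exact: outY_gt0 hw.
have EU : rsum (fun xs : {ffun 'I_n -> X} => rsum (fun ys : {ffun 'I_n -> Y} => Pn p xs ys * U xs ys)) <= c.
  apply: Rle_trans (_ : rsum (fun xs : {ffun 'I_n -> X} => rsum (fun ys : {ffun 'I_n -> Y} => rprod (fun i =>
      pY p (ys i) * (r i (V i xs ys) (xs i) (ys i) * Q i (m xs) ys (V i xs ys))))) <= _).
    apply: rsum_le => xs; apply: rsum_le => ys.
    case: (Pn_ge0 xs ys p0) => [P0|<-].
      rewrite /U -rprodM; apply: Req_le; apply: rprod_ext => i.
      have pi := Pn_gt0_inv p0 P0 i; have hw := wp i xs ys P0.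
      have o := outY_gt0 p0 (w0 i) hw.
      by rewrite /u /r; field; lra.
    rewrite Rmult_0_l; apply: rprod_ge0 => i; apply: Rmult_le_pos; first exact: pY_ge0.
    by apply: Rmult_le_pos => //; exact: Rlt_le.
  (* [m xs] and the V_i couple the places. Letting message and sets range freely only adds
     nonnegative terms, and for fixed ys and message the sum then factors over i. The free message
     costs the factor [c]. *)
  apply: Rle_trans (_ : rsum (fun ys : {ffun 'I_n -> Y} => rsum (fun mm : Msg =>
      rsum (fun xs : {ffun 'I_n -> X} => rsum (fun vs : {ffun 'I_n -> {set X}} =>
      rprod (fun i => pY p (ys i) * (r i (vs i) (xs i) (ys i) * Q i mm ys (vs i))))))) <= _).
    rewrite rsum_exch; apply: rsum_le => ys; rewrite rsum_exch; apply: rsum_le => xs.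
    have t0 mm (vs : {ffun 'I_n -> {set X}}) :
        0 <= rprod (fun i => pY p (ys i) * (r i (vs i) (xs i) (ys i) * Q i mm ys (vs i))).
      apply: rprod_ge0 => i; apply: Rmult_le_pos; first exact: pY_ge0.
      by apply: Rmult_le_pos => //; exact: Rlt_le.
    apply: Rle_trans (rsum_ge1 (m xs) (fun mm => rsum_ge0 (t0 mm))).
    apply: Rle_trans (rsum_ge1 [ffun i => V i xs ys] (t0 (m xs))).
    by apply: Req_le; apply: rprod_ext => i; rewrite ffunE.
  apply: Rle_trans (_ : rsum (fun ys : {ffun 'I_n -> Y} => rsum (fun mm : Msg =>
      rprod (fun i => pY p (ys i)))) <= _).
    apply: rsum_le => ys; apply: rsum_le => mm.
    rewrite (rsum2_rprod (fun i x v => pY p (ys i) * (r i v x (ys i) * Q i mm ys v))).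
    apply: rprod_le => i; split.
      apply: rsum_ge0 => x; apply: rsum_ge0 => v.
      apply: Rmult_le_pos; first exact: pY_ge0.
      by apply: Rmult_le_pos => //; exact: Rlt_le.
    have hs : rsum (fun x => rsum (fun v => r i v x (ys i) * Q i mm ys v)) <= 1.
      apply: Rle_trans (Q1 i mm ys); rewrite rsum_exch; apply: rsum_le => v.
      rewrite -rsumZr -[X in _ <= X]Rmult_1_l; apply: Rmult_le_compat_r; first exact: Rlt_le.
      rewrite /r /Rdiv -rsumZr -/(outY p (w i) v (ys i)).
      case: (outY_ge0 v (ys i) p0 (w0 i)) => [h|<-]; last by lra.
      by rewrite Rinv_r; lra.
    have := pY_ge0 (ys i) p0 => hy.
    have -> : rsum (fun x => rsum (fun v => pY p (ys i) * (r i v x (ys i) * Q i mm ys v)))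
      = pY p (ys i) * rsum (fun x => rsum (fun v => r i v x (ys i) * Q i mm ys v)).
      by rewrite rsumZl; apply: rsum_ext => x; rewrite rsumZl.
    rewrite -[X in _ <= X]Rmult_1_r; exact: Rmult_le_compat_l hy hs.
  rewrite rsum_exch rsum_const (rsum_rprod (fun (i : 'I_n) y => pY p y)) pY_sum1 //.
  by rewrite rprod_const pow1 /c; lra.
have EMI i : cond_MI p (w i) * ln 2 = rsum (fun xs : {ffun 'I_n -> X} => rsum (fun ys : {ffun 'I_n -> Y} =>
    Pn p xs ys * ln (u i (V i xs ys) (xs i) (ys i)))).
  by rewrite cond_MI_sum // -(chan_of_joint (fun v x y => ln (u i v x y)) p0 (hV i)).
rewrite (rsum_ext EMI) -rsumD.
rewrite (rsum_ext (h := fun i => rsum (fun xs : {ffun 'I_n -> X} => rsum (fun ys : {ffun 'I_n -> Y} =>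
    Pn p xs ys * (ln (u i (V i xs ys) (xs i) (ys i)) + ln (Q i (m xs) ys (V i xs ys))))))); last first.
  move=> i; rewrite -rsumD; apply: rsum_ext => xs; rewrite -rsumD.
  by apply: rsum_ext => ys; ring.
rewrite rsum_exch.
(* The tangent of ln at [c]: ln U <= U / c + ln c - 1, where the mean of U / c is at most 1. *)
apply: Rle_trans (_ : rsum (fun xs : {ffun 'I_n -> X} => rsum (fun ys : {ffun 'I_n -> Y} =>
    Pn p xs ys * U xs ys * / c + Pn p xs ys * (ln c - 1))) <= _).
  apply: rsum_le => xs; rewrite rsum_exch; apply: rsum_le => ys.
  rewrite -rsumZl; case: (Pn_ge0 xs ys p0) => [P0|<-]; last by lra.
  have up' i : 0 < u i (V i xs ys) (xs i) (ys i) * Q i (m xs) ys (V i xs ys).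
    by apply: Rmult_lt_0_compat => //; exact: up.
  have U0 : 0 < U xs ys by exact: rprod_gt0.
  have -> : rsum (fun i => ln (u i (V i xs ys) (xs i) (ys i)) +
      ln (Q i (m xs) ys (V i xs ys))) = ln (U xs ys).
    rewrite ln_rprod //; apply: rsum_ext => i; rewrite ln_mult //; exact: up.
  have := ln_le_sub1 (Rdiv_lt_0_compat _ _ U0 c0).
  rewrite /Rdiv ln_mult ?ln_Rinv //; last exact: Rinv_0_lt_compat.
  nra.
rewrite (rsum_ext (h := fun xs => rsum (fun ys : {ffun 'I_n -> Y} => Pn p xs ys * U xs ys) * / c +
  rsum (fun ys : {ffun 'I_n -> Y} => Pn p xs ys) * (ln c - 1))); last first.
  by move=> xs; rewrite rsumD -!rsumZr.
rewrite rsumD -!rsumZr (proj2 (Pn_pmf n pmf)) Rmult_1_l.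
have := Rmult_le_compat_r _ _ _ (Rlt_le _ _ (Rinv_0_lt_compat _ c0)) EU.
rewrite Rinv_r; last lra.
set z := _ * _; rewrite -/c; lra.
Qed.

(** * Independent sets read off the decoder *)

Lemma min_positive (X Y : finType) (p : X -> Y -> R) : is_pmf p ->
  exists pi, 0 < pi /\ forall x y, 0 < p x y -> pi <= p x y.
Proof.
move=> [p0 p1].
have ple x y : p x y <= 1.
  rewrite -p1; apply: Rle_trans (rsum_ge1 x (fun x => rsum_ge0 (p0 x))).
  exact: (rsum_ge1 y (p0 x)).
pose g (z : X * Y) := if posb (p z.1 z.2) then p z.1 z.2 else 1.
have g01 z : 0 < g z <= 1 by rewrite /g; case: posbP => h; have := ple z.1 z.2; lra.
exists (rprod g); split; first by apply: rprod_gt0 => z; have := g01 z; lra.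
move=> x y h; rewrite (rprod_split1 _ (x, y)).
have -> : g (x, y) = p x y by rewrite /g /=; case: posbP.
rewrite -[X in _ <= X]Rmult_1_r; apply: Rmult_le_compat_l; first exact: p0.
suff : 0 <= \big[Rmult/1]_(z | z != (x, y)) g z <= 1 by lra.
apply: (big_ind (fun t => 0 <= t <= 1)) => [|s t hs ht|z _]; [lra|nra|].
have := g01 z; lra.
Qed.

Definition rec_set (X Y F Msg : finType) (p : X -> Y -> R) (f : X -> Y -> F) (n : nat)
  (g : Msg -> {ffun 'I_n -> Y} -> {ffun 'I_n -> F}) (i : 'I_n) (mm : Msg)
  (ys : {ffun 'I_n -> Y}) : {set X} :=
  [set x | [forall y, posb (p x y) ==> (g mm (upd ys i y) i == f x y)]].

Lemma rec_set_upd (X Y F Msg : finType) (p : X -> Y -> R) (f : X -> Y -> F) (n : nat)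
    (g : Msg -> {ffun 'I_n -> Y} -> {ffun 'I_n -> F}) i mm ys y :
  rec_set p f g i mm (upd ys i y) = rec_set p f g i mm ys.
Proof.
by apply/setP => x; rewrite !inE; apply: eq_forallb => y'; rewrite upd_upd.
Qed.

(** At a y compatible with both letters the decoder has a single output, equal to both values of
    f. *)
Lemma rec_set_indep (X Y F Msg : finType) (p : X -> Y -> R) (f : X -> Y -> F) (n : nat)
    (g : Msg -> {ffun 'I_n -> Y} -> {ffun 'I_n -> F}) i mm ys :
  (forall x y, 0 <= p x y) -> indep_set p f (rec_set p f g i mm ys).
Proof.
move=> p0 x1 x2; rewrite !inE => /forallP h1 /forallP h2 [y [pp]]; case.
have /posbP q1 : 0 < p x1 y by have := p0 x1 y; have := p0 x2 y; nra.
have /posbP q2 : 0 < p x2 y by have := p0 x1 y; have := p0 x2 y; nra.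
by rewrite -(eqP (implyP (h1 y) q1)) -(eqP (implyP (h2 y) q2)).
Qed.

Definition rec_var (X Y F Msg : finType) (p : X -> Y -> R) (f : X -> Y -> F) (n : nat)
  (m : {ffun 'I_n -> X} -> Msg) (g : Msg -> {ffun 'I_n -> Y} -> {ffun 'I_n -> F})
  (i : 'I_n) (xs : {ffun 'I_n -> X}) (ys : {ffun 'I_n -> Y}) : {set X} :=
  if xs i \in rec_set p f g i (m xs) ys then rec_set p f g i (m xs) ys else [set xs i].

Lemma rec_chan_admissible (X Y F Msg : finType) (p : X -> Y -> R) (f : X -> Y -> F) (n : nat)
    (m : {ffun 'I_n -> X} -> Msg) (g : Msg -> {ffun 'I_n -> Y} -> {ffun 'I_n -> F}) i :
  is_pmf p -> admissible_V p f (chan_of p i (rec_var p f m g i)).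
Proof.
move=> pmf; have [p0 _] := pmf.
split; first by move=> v x; exact: chan_of_ge0.
split; first by move=> x; exact: chan_of_sum1.
move=> v x /(chan_of_support p0) [xs [ys [-> ->]]]; rewrite /rec_var.
case: ifP => [h|_]; first by split=> //; exact: rec_set_indep.
by split; [move=> x1 x2 /set1P -> /set1P -> [y []]|rewrite inE].
Qed.

(** If X_i is outside the set, some y with p(X_i, y) >= pi fools the decoder at place i. Redrawing
    Y_i hits this y with weight at least pi and, by [resample], preserves the law up to the factor
    pX(X_i) <= 1. *)
Lemma rec_set_error (X Y F Msg : finType) (p : X -> Y -> R) (f : X -> Y -> F) (n : nat)
    (m : {ffun 'I_n -> X} -> Msg) (g : Msg -> {ffun 'I_n -> Y} -> {ffun 'I_n -> F})
    (i : 'I_n) (pi : R) :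
  is_pmf p -> 0 < pi -> (forall x y, 0 < p x y -> pi <= p x y) ->
  pi * rsum (fun xs : {ffun 'I_n -> X} => rsum (fun ys : {ffun 'I_n -> Y} =>
    indic (xs i \notin rec_set p f g i (m xs) ys) * Pn p xs ys)) <=
  rsum (fun xs : {ffun 'I_n -> X} => rsum (fun ys : {ffun 'I_n -> Y} =>
    indic (g (m xs) ys != fseq f xs ys) * Pn p xs ys)).
Proof.
move=> [p0 p1] pi0 hpi; rewrite rsumZl; apply: rsum_le => xs.
pose phi ys := indic (g (m xs) ys i != f (xs i) (ys i)).
apply: Rle_trans (_ : pX p (xs i) * rsum (fun ys => Pn p xs ys * phi ys) <= _).
  rewrite -resample rsumZl; apply: rsum_le => ys.
  have P0 := Pn_ge0 xs ys p0.
  have t0 y : 0 <= p (xs i) y * phi (upd ys i y).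
    by apply: Rmult_le_pos => //; exact: indic_ge0.
  case: (boolP (xs i \in _)) => [_|] /=.
    by rewrite Rmult_0_l Rmult_0_r; apply: Rmult_le_pos => //; exact: rsum_ge0.
  rewrite inE => /forallPn [y]; rewrite negb_imply => /andP [/posbP py ne].
  rewrite Rmult_1_l Rmult_comm; apply: Rmult_le_compat_l => //.
  apply: Rle_trans (hpi _ _ py) _.
  apply: Rle_trans (rsum_ge1 y t0).
  by rewrite /phi upd_same ne /=; lra.
have pX1 : pX p (xs i) <= 1.
  by rewrite -p1; apply: (rsum_ge1 (xs i) (fun x => rsum_ge0 (p0 x))).
have s0 : 0 <= rsum (fun ys => Pn p xs ys * phi ys).
  by apply: rsum_ge0 => ys; apply: Rmult_le_pos (Pn_ge0 _ _ p0) (indic_ge0 _).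
apply: Rle_trans (Rmult_le_compat_r _ _ _ s0 pX1) _; rewrite Rmult_1_l.
apply: rsum_le => ys; rewrite Rmult_comm; apply: Rmult_le_compat_r; first exact: Pn_ge0.
rewrite /phi; case: eqP => [_|ne] /=; first exact: indic_ge0.
case: eqP => [e|_] /=; last lra.
by case: ne; rewrite e ffunE.
Qed.

Lemma ln_le_compat (x y : R) : 0 < x -> x <= y -> ln x <= ln y.
Proof. by move=> x0 [h|->]; [apply/Rlt_le/ln_increasing|lra]. Qed.

Lemma ln_INR_card_le (T : finType) (x : R) :
  (0 < #|T|)%nat -> INR #|T| <= exp x -> ln (INR #|T|) <= x.
Proof.
move=> T0 h; rewrite -[x]ln_exp; apply: ln_le_compat => //.
by apply: lt_0_INR; exact/ltP.
Qed.

Lemma single_letter_converse (X Y F Msg : finType) (p : X -> Y -> R) (f : X -> Y -> F) (n : nat)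
    (m : {ffun 'I_n -> X} -> Msg) (g : Msg -> {ffun 'I_n -> Y} -> {ffun 'I_n -> F})
    (pi d eps : R) :
  is_pmf p -> 0 < pi -> (forall x y, 0 < p x y -> pi <= p x y) -> 0 < d < 1 ->
  rsum (fun xs : {ffun 'I_n -> X} => rsum (fun ys : {ffun 'I_n -> Y} =>
    indic (g (m xs) ys != fseq f xs ys) * Pn p xs ys)) <= eps ->
  INR n * (cond_graph_entropy p f * ln 2) <=
    ln (INR #|Msg|) + INR n * (- ln (1 - d) - eps / pi * ln (d / INR #|{: {set X}}|)).
Proof.
move=> pmf pi0 hpi d01 herr; have [p0 p1] := pmf.
pose K := INR #|{: {set X}}|.
have K1 : 1 <= K.
  by rewrite -INR_1; apply/le_INR/leP/card_gt0P; exists set0.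
have dK : 0 < d / K by apply: Rdiv_lt_0_compat; lra.
have dK1 : d / K < 1.
  by apply: (Rmult_lt_reg_r K); [lra|rewrite /Rdiv Rmult_assoc Rinv_l; lra].
pose V i := rec_var p f m g i.
(* The guess A_i, smoothed by a uniform part over the K subsets so that the fallback singletons also
   get positive mass. The cost is -ln (1 - d) always, and at most -ln (d / K) more when X_i is
   outside A_i. *)
pose Q i mm ys v := (1 - d) * indic (v == rec_set p f g i mm ys) + d / K.
have Q0 i mm ys v : 0 < Q i mm ys v.
  by rewrite /Q; have := indic_ge0 (v == rec_set p f g i mm ys); nra.
have Q1 i mm ys : rsum (Q i mm ys) <= 1.
  rewrite /Q rsumD -rsumZl rsum_const.
  have -> : rsum (fun v => indic (v == rec_set p f g i mm ys)) = 1.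
    rewrite -[RHS](rsum_eq1 (fun _ => 1) (rec_set p f g i mm ys)).
    by apply: rsum_ext => v; rewrite Rmult_1_r.
  by rewrite -/K; apply: Req_le; field; lra.
have hV i xs ys y : V i xs (upd ys i y) = V i xs ys.
  by rewrite /V /rec_var rec_set_upd.
have := message_bound m pmf hV Q0 Q1.
set S1 := rsum _; set S2 := rsum _ => hS.
have h1 : INR n * (cond_graph_entropy p f * ln 2) <= S1.
  rewrite -{1}(card_ord n) -rsum_const; apply: rsum_le => i.
  apply: Rmult_le_compat_r; first exact: Rlt_le ln2_gt0.
  apply: (proj1 (cond_graph_entropy_glb f pmf)).
  by exists (chan_of p i (V i)); split=> //; exact: rec_chan_admissible.
have l1 : ln (d / K) < 0 by rewrite -ln_1; apply: ln_increasing.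
have l2 : ln (1 - d) < 0 by rewrite -ln_1; apply: ln_increasing; lra.
have h2 : INR n * (ln (1 - d) + eps / pi * ln (d / K)) <= S2.
  rewrite -{1}(card_ord n) -rsum_const; apply: rsum_le => i.
  have := rec_set_error f m g i pmf pi0 hpi; set E := rsum _ => hE.
  have E1 : E <= eps / pi.
    apply: (Rmult_le_reg_l pi) => //; apply: Rle_trans hE _.
    by apply: Rle_trans herr _; apply: Req_le; field; lra.
  apply: Rle_trans (_ : ln (1 - d) + E * ln (d / K) <= _); first nra.
  have tot (t : R) : t = rsum (fun xs => rsum (fun ys => @Pn X Y p n xs ys)) * t.
    by rewrite (proj2 (Pn_pmf n pmf)) Rmult_1_l.
  rewrite [ln (1 - d)]tot /E !rsumZr -rsumD.
  apply: rsum_le => xs; rewrite !rsumZr -rsumD; apply: rsum_le => ys.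
  have P0 := Pn_ge0 xs ys p0.
  suff h : ln (1 - d) + indic (xs i \notin rec_set p f g i (m xs) ys) * ln (d / K)
      <= ln (Q i (m xs) ys (V i xs ys)).
    apply: Rle_trans (Rmult_le_compat_l _ _ _ P0 h); apply: Req_le.
    have re (a b c e : R) : a * b + c * a * e = a * (b + c * e) by ring.
    exact: re.
  rewrite /V /rec_var; case: ifP => [hx|hx].
    rewrite Rmult_0_l Rplus_0_r; apply: ln_le_compat; first lra.
    by rewrite /Q eqxx /=; lra.
  rewrite Rmult_1_l; apply: Rle_trans (_ : ln (d / K) <= _); first lra.
  apply: ln_le_compat => //; rewrite /Q.
  rewrite -[X in X <= _]Rplus_0_l; apply: Rplus_le_compat_r.
  by apply: Rmult_le_pos (indic_ge0 _); lra.
have comb (A s1 s2 L B : R) : s1 + s2 <= L -> A <= s1 -> - B <= s2 -> A <= L + B by lra.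
apply: comb hS h1 _; apply: Rle_trans h2; apply: Req_le; rewrite /K; ring.
Qed.

Lemma description_rate_converse (X Y F : finType) (p : X -> Y -> R) (f : X -> Y -> F)
    (a b c : R) :
  is_pmf p -> achievable p f a b c -> cond_graph_entropy p f <= a + b.
Proof.
move=> pmf ach; have [p0 p1] := pmf; have l2 := ln2_gt0.
have [pi [pi0 hpi]] := min_positive pmf.
apply: Rnot_lt_le => hlt.
pose eta := (cond_graph_entropy p f - (a + b)) * ln 2.
have eta0 : 0 < eta by apply: Rmult_lt_0_compat; lra.
(* [d] makes -ln (1 - d) equal to eta / 4, and [eps] below, chosen after [d], keeps the cost of the
   bad event under eta / 4; together they stay below the gap [eta]. *)
pose d := 1 - exp (- (eta / 4)).
have d01 : 0 < d < 1.
  have := exp_pos (- (eta / 4)).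
  have : exp (- (eta / 4)) < 1 by rewrite -exp_0; apply: exp_increasing; lra.
  by rewrite /d; lra.
have ld : ln (1 - d) = - (eta / 4).
  by rewrite /d -[RHS]ln_exp; congr ln; ring.
pose L := ln (d / INR #|{: {set X}}|).
pose eps := pi * (eta / 4) / (1 + Rabs L).
have L0 : 0 < 1 + Rabs L by have := Rabs_pos L; lra.
have eps0 : 0 < eps by apply: Rdiv_lt_0_compat => //; apply: Rmult_lt_0_compat; lra.
have [N hN] := ach eps eps0.
(* A positive blocklength, so that the factor [INR n] can be cancelled at the end. *)
have [phi0 [phiX [phiY [psi he]]]] := hN N.+1 (leqnSn N).
set n := N.+1 in phi0 phiX phiY psi he.
have n0 : 0 < INR n by apply: lt_0_INR; exact/ltP.
(* Both descriptions of X^n form one message: with Y^n they determine the output, and there are at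
   most 2^(n (a + b)) of them. *)
pose m xs := (phi0 xs, phiX xs).
pose g (mm : 'I_(msgs n a) * 'I_(msgs n b)) ys := psi mm.2 (phiY ys mm.1).
have := @single_letter_converse X Y F _ p f n m g pi d eps pmf pi0 hpi d01.
have he' : rsum (fun xs => rsum (fun ys =>
    indic (g (m xs) ys != fseq f xs ys) * Pn p xs ys)) <= eps.
  apply: Rle_trans he; apply: Req_le; apply: rsum_ext => xs; apply: rsum_ext => ys.
  by rewrite /g /m /=; case: ifP => _ /=; ring.
move=> /(_ he'); rewrite -/L ld.
have epsL : - (eps / pi * L) <= eta / 4.
  have [q qE] : exists q, q = eps / pi by exists (eps / pi).
  have q0 : 0 < q by rewrite qE; exact: Rdiv_lt_0_compat.
  have e4 : q * (1 + Rabs L) = eta / 4 by rewrite qE /eps; field; lra.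
  have hL : - L <= 1 + Rabs L by have := Rle_abs (- L); rewrite Rabs_Ropp; lra.
  by rewrite -qE -e4; nra.
have [xs0 _] : exists xs, 0 < rsum (fun ys => @Pn X Y p n xs ys).
  by apply: rsum_gt0_ex; rewrite (proj2 (Pn_pmf n pmf)); lra.
have lM : ln (INR #|{: 'I_(msgs n a) * 'I_(msgs n b)}|) <= INR n * ((a + b) * ln 2).
  apply: ln_INR_card_le; first by apply/card_gt0P; exists (m xs0).
  rewrite card_prod !card_ord mult_INR.
  have -> : INR n * ((a + b) * ln 2) = INR n * a * ln 2 + INR n * b * ln 2 by ring.
  rewrite exp_plus; apply: Rmult_le_compat; try exact: pos_INR.
    exact: (proj2 (msgs_bounds n a)).
  exact: (proj2 (msgs_bounds n b)).
move=> h.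
have {h} h : INR n * (cond_graph_entropy p f * ln 2) <=
    INR n * ((a + b) * ln 2) + INR n * (eta / 4 + eta / 4).
  apply: Rle_trans h _; apply: Rplus_le_compat lM _.
  by apply: Rmult_le_compat_l; lra.
have : INR n * eta <= INR n * (eta / 4 + eta / 4) by rewrite {1}/eta; lra.
nra.
Qed.

Theorem theorem6 (X Y F : finType) (p : X -> Y -> R) (f : X -> Y -> F)
  (hp : is_pmf p) (R0 RY : R) :
  in_rate_region p f R0 0 RY <->
  (cond_graph_entropy p f <= R0 /\ entropy_f p f <= RY)%R.
Proof.
split=> [reg|[hG hf] d d0].
  (* Two rates of the approximating triple enter each bound, each off by less than e / 2. *)
  split; apply: le_epsilon => e e0.
    have [|a [b [c [ach [ha [hb _]]]]]] := reg (e / 2); first lra.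
    have := description_rate_converse hp ach.
    by move: ha hb => /Rabs_def2 ha /Rabs_def2 hb; lra.
  have [|a [b [c [ach [_ [hb hc]]]]]] := reg (e / 2); first lra.
  have := function_rate_converse hp ach.
  by move: hb hc => /Rabs_def2 hb /Rabs_def2 hc; lra.
(* Boundary points need the closure: the shift by d / 2 supplies the strict inequalities of
   [achievable_above]. *)
exists (R0 + d / 2), 0, (RY + d / 2); split.
  by apply: achievable_above => //; lra.
by split; [|split]; apply: Rabs_def1; lra.
Qed.
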